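(* Let $N$ be even, and for $0\le j\le N/2-1$ let $$q_{2j}(x)=x^{2j},\qquad q_{2j+1}(x)=x^{N-1-2j}.$$ With respect to the skew inner product $\langle\cdot,\cdot\rangle_S=\langle\cdot,\cdot\rangle_\alpha+\langle\cdot,\cdot\rangle_\beta$ of the context, these polynomials satisfy, for $0\le j,l\le N/2-1$, $$\langle q_{2j},q_{2l}\rangle_S=\langle q_{2j+1},q_{2l+1}\rangle_S=0,\qquad\langle q_{2j},q_{2l+1}\rangle_S=-\langle q_{2l+1},q_{2j}\rangle_S=\delta_{j,l}\,(\hat\alpha_j+\hat\beta_j),$$ where $\hat\alpha_l:=\langle q_{2l},q_{2l+1}\rangle_\alpha$ and $\hat\beta_l:=\langle q_{2l},q_{2l+1}\rangle_\beta$ are given by $$\hat\alpha_l=\frac{2\pi}{N-1-4l}\,\frac{\Gamma((N+1)/2)}{\Gamma(N/2+1)},$$ $$\hat\beta_l=\frac{2\sqrt\pi}{N-1-4l}\left(2^N\,\frac{\Gamma(2l+1)\Gamma(N-2l)}{\Gamma(N+1)}-\sqrt\pi\,\frac{\Gamma((N+1)/2)}{\Gamma(N/2+1)}\right).$$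
   Context: Put $$\tau(x)=x^{-(N-1)/2}\left[\frac1{\sqrt\pi}\int_{\left||x|^{-1}-|x|\right|/2}^\infty\frac{dt}{(1+t^2)^{N/2+1}}\right]^{1/2},\qquad x^{-(N-1)/2}:=|x|^{-(N-1)/2}e^{-i(N-1)\arg(x)/2},\ \arg x\in[0,2\pi).$$ For polynomials $p,q$, with $e_a=e^{i\theta_a}$ and $\Omega$ the open unit disk (with $dw$ planar Lebesgue measure), $$\langle p,q\rangle_\alpha=-\frac i2\int_0^{2\pi}d\theta_1\,\tau(e_1)\int_0^{2\pi}d\theta_2\,\tau(e_2)\,p(e_1)q(e_2)\,\mathrm{sgn}(\theta_2-\theta_1),$$ $$\langle p,q\rangle_\beta=\int_\Omega dw\,\tau(w)\,\tau\!\Big(\frac1{\bar w}\Big)\frac1{|w|^2}\left(p(w)\,q\Big(\frac1{\bar w}\Big)-q(w)\,p\Big(\frac1{\bar w}\Big)\right),$$ and $\langle p,q\rangle_S=\langle p,q\rangle_\alpha+\langle p,q\rangle_\beta$. *)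

(* Defs.v *)
From mathcomp Require Export all_boot all_order all_algebra.
From mathcomp Require Export all_classical all_reals all_analysis.
From mathcomp Require Export complex.
Export Order.TTheory GRing.Theory Num.Theory.
Export numFieldNormedType.Exports.

Set Implicit Arguments.
Unset Strict Implicit.
Unset Printing Implicit Defensive.

Local Open Scope classical_set_scope.
Local Open Scope ring_scope.
Local Open Scope complex_scope.

Definition Cintegral d (T : measurableType d) (R : realType)
    (mu : {measure set T -> \bar R}) (D : set T) (f : T -> R[i]) : R[i] :=
  (\int[mu]_(x in D) complex.Re (f x)) +i* (\int[mu]_(x in D) complex.Im (f x)).

Definition Gamma (R : realType) (s : R) : R :=
  \int[lebesgue_measure]_(t in `]0, +oo[) (t `^ (s - 1) * expR (- t)).

Definition modulus (R : realType) (x : R[i]) : R := ComplexField.Normc.normc x.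

Definition expi (R : realType) (t : R) : R[i] := cos t +i* sin t.

(* For x != 0 the set below is a singleton.  For x = 0 it is all of [0, 2 pi[
   and the value is an arbitrary one, which affects tau only at the origin. *)
Definition arg (R : realType) (x : R[i]) : R :=
  xget 0 [set t | 0 <= t < 2 * pi /\ x = (modulus x)%:C * expi t].

Definition tau (R : realType) (N : nat) (x : R[i]) : R[i] :=
  let s : R := (N%:R - 1) / 2 in
  (modulus x `^ (- s))%:C * expi (- (s * arg x)) *
  (Num.sqrt ((Num.sqrt pi)^-1 *
     \int[lebesgue_measure]_(t in `[`|(modulus x)^-1 - modulus x| / 2, +oo[)
        ((1 + t ^+ 2) `^ (N%:R / 2 + 1))^-1))%:C.

Definition ip_alpha (R : realType) (N : nat) (p q : {poly R[i]}) : R[i] :=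
  let mu := @lebesgue_measure R in
  - ('i / 2) *
  Cintegral mu `[0, 2 * pi] (fun t1 : R => tau N (expi t1) *
    Cintegral mu `[0, 2 * pi] (fun t2 : R =>
      tau N (expi t2) * p.[expi t1] * q.[expi t2] * (Num.sg (t2 - t1))%:C)).

(* The plane is R * R with the product of Lebesgue measures; (u, v) stands for
   w = u + i v. *)
Definition ip_beta (R : realType) (N : nat) (p q : {poly R[i]}) : R[i] :=
  let mu := @lebesgue_measure R in
  Cintegral (mu \x mu)%E [set z | modulus (z.1 +i* z.2) < 1] (fun z : R * R =>
    let w := z.1 +i* z.2 in
    let w' := (conjc w)^-1 in
    tau N w * tau N w' * ((modulus w ^+ 2)^-1)%:C *
    (p.[w] * q.[w'] - q.[w] * p.[w'])).

Definition ip_S (R : realType) (N : nat) (p q : {poly R[i]}) : R[i] :=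
  ip_alpha N p q + ip_beta N p q.

(* Main.v *)
Require Import Defs.
From mathcomp Require Import ring lra zify measurable_realfun.

(** Idea.  In polar coordinates the twist exp(-i(N-1)theta/2) of tau turns both
    products of x^a and x^b into an integral of exp(i(a+b-N+1)theta) against a
    radial (or constant) weight, so everything vanishes unless a + b = N - 1.
    For alpha the remaining integral is elementary, because a - (N-1)/2 and
    b - (N-1)/2 are half-integers.  Polar coordinates on the plane are obtained
    from Tonelli and one-dimensional scaling only: fold onto the quadrant
    x, y > 0, put y = x u and then x = r / sqrt(1 + u^2).  For beta, with
    k = |a - b| and G(r) the integral in tau, the radial integral of
    r^-1 (r^-k - r^k) G(r) over ]0, 1[ is integrated by parts; since G'(r) is a
    multiple of r^N / (1 + r^2)^(N+1), what remains is a beta integral in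
    u = r^2 / (1 + r^2).  Finally G(1) is a Wallis integral, related to
    Gamma((N+1)/2) / Gamma(N/2+1) by Tonelli and the Gaussian integral. *)

(** The obstacle is convergence at the origin: for k > 0 the factor r^-1 (r^-k - r^k) has a pole of
    order k + 1, compensated because G(r) = o(r^N) and k < N. When a + b = N - 1 with N even, a and
    b have different parities, so k is odd and N = 2 p + k + 1 with p = min(a, b); hence the integer
    exponents of the beta integral. When a + b differs from N - 1 the angular factor vanishes, but
    this is conclusive only for an integrable product, so for even k the radial integral is bounded
    by the one for k + 1. Since Tonelli is applied to nonnegative integrands, an oscillating angular
    factor c enters as 1 + c, and the contribution of 1 is subtracted afterwards. *)

Local Open Scope classical_set_scope.
Local Open Scope ring_scope.
Local Open Scope complex_scope.

(** * Linear changes of variable for the Lebesgue measure on the line *)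

Section scaling.
Context {R : realType}.
Let mu := @lebesgue_measure R.
Local Open Scope ereal_scope.

(** The image of the Lebesgue measure under multiplication by c, times c, gives each interval ]a, b]
    its length, hence is the Lebesgue measure by uniqueness. Arguing on measures covers every
    nonnegative measurable f, even with infinite integral. *)
Lemma ge0_integral_scale (c : R) (f : R -> \bar R) : (0 < c)%R ->
  measurable_fun setT f -> (forall x, 0 <= f x) ->
  \int[mu]_x f x = c%:E * \int[mu]_x f (c * x)%R.
Proof.
move=> c0 mf f0.
have mphi : measurable_fun [set: measurableTypeR R]
    ((fun x => c * x)%R : measurableTypeR R -> measurableTypeR R).
  exact: mulrl_measurable.
pose phi : measurableTypeR R -> measurableTypeR R := fun x => (c * x)%R.
have c0' : (0 <= c)%R by exact: ltW.
pose nu :=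
  mscale (NngNum c0') (pushforward mu phi).
have E : forall A, measurable A -> mu A = nu mphi A.
  apply: lebesgue_measure_unique => _ [[a b] _ <-].
  rewrite /nu /= /mscale /= /pushforward.
  have -> : phi @^-1` `]a, b] = `](a / c)%R, (b / c)%R]%classic.
    apply/seteqP; split => x /=; rewrite !in_itv /= /phi;
    by rewrite ltr_pdivrMr// ler_pdivlMr// mulrC.
  rewrite !lebesgue_measure_itv /= !lte_fin ltr_pM2r ?invr_gt0//.
  case: ifP => ab; last by rewrite mule0.
  rewrite -!EFinD -EFinM; congr EFin.
  by field; rewrite gt_eqF.
transitivity (\int[nu mphi]_x f x).
  by apply: eq_measure_integral => A mA _; exact: E.
rewrite ge0_integral_mscale//=; congr *%E.
rewrite ge0_integral_pushforward//.
Qed.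

(** Reflection invariance of the measure carries x < 0 onto x > 0. The indicator drops the origin,
    hence the final comparison almost everywhere. *)
Lemma ge0_integral_setT_fold (g : R -> \bar R) :
  measurable_fun setT g -> (forall x, 0 <= g x) ->
  \int[mu]_x g x = \int[mu]_x ((g x + g (- x)%R) * (0 < x)%R%:R%:E).
Proof.
move=> mg g0.
have mI : measurable_fun setT (fun x : R => ((0 < x)%R%:R : R)%:E).
  apply/measurable_EFinP; apply: measurableT_comp => //.
  exact: measurable_fun_ltr.
have mgN : measurable_fun setT (fun x : R => g (- x)%R).
  exact: measurableT_comp.
under [RHS]eq_integral do rewrite ge0_muleDl//.
rewrite ge0_integralD//; last 4 first.
  by move=> x _; rewrite mule_ge0// lee_fin.
  exact: emeasurable_funM.
  by move=> x _; rewrite mule_ge0// lee_fin.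
  exact: emeasurable_funM.
have -> : \int[mu]_x (g (- x)%R * (0 < x)%R%:R%:E) =
  \int[mu]_x (g x * (x < 0)%R%:R%:E).
  pose phi : measurableTypeR R -> measurableTypeR R := -%R.
  have mphi : measurable_fun setT phi by exact: oppr_measurable.
  pose nu : {measure set (measurableTypeR R) -> \bar R} := pushforward mu phi.
  transitivity (\int[nu mphi]_x (g x * (x < 0)%R%:R%:E)).
    rewrite ge0_integral_pushforward//; last 2 first.
    - apply: emeasurable_funM => //; apply/measurable_EFinP.
      by apply: measurableT_comp => //; exact: measurable_fun_ltr.
    - by move=> x _; rewrite mule_ge0// lee_fin.
    by rewrite preimage_setT; apply: eq_integral => x _ /=; rewrite oppr_lt0.
  by apply: eq_measure_integral => A mA _; exact: lebesgue_measureN.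
rewrite -ge0_integralD//; last 4 first.
  by move=> x _; rewrite mule_ge0// lee_fin.
  exact: emeasurable_funM.
  by move=> x _; rewrite mule_ge0// lee_fin.
  apply: emeasurable_funM => //; apply/measurable_EFinP.
  by apply: measurableT_comp => //; exact: measurable_fun_ltr.
apply: ae_eq_integral => //.
- apply: emeasurable_funD; apply: emeasurable_funM => //; apply/measurable_EFinP.
  by apply: measurableT_comp => //; exact: measurable_fun_ltr.
- exists [set 0%R]; split => //; first exact: lebesgue_measure_set1.
  move=> x /=; apply: contra_notP => /eqP; case: ltgtP => // x0 _ _;
  by rewrite mule1 mule0 ?add0e ?adde0.
Qed.

End scaling.

(** * Polar coordinates for nonnegative functions *)

Section polar.
Context {R : realType}.
Let mu := @lebesgue_measure R.
Local Open Scope ereal_scope.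

(** For x > 0 the substitution y = x u produces a factor x. After the exchange of integrals, r = x
    sqrt(1 + u^2) costs one square root through dx and one through x, which leaves 1 / (1 + u^2),
    the derivative of the angle atan u. As h vanishes for r <= 0, all integrals run over the whole
    line, as scaling requires. *)
Lemma ge0_integral_quadrant (C h : R -> R) :
  measurable_fun setT C -> measurable_fun setT h ->
  (forall u : R, 0 <= C u)%R -> (forall r : R, 0 <= h r)%R ->
  (forall r : R, r <= 0 -> h r = 0)%R ->
  \int[mu]_x ((\int[mu]_y (C (y / x) * h (Num.sqrt (x ^+ 2 + y ^+ 2)))%:E)
    * (0 < x)%R%:R%:E) =
  \int[mu]_u (C u / (1 + u ^+ 2))%:E * \int[mu]_r (r * h r)%:E.
Proof.
move=> mC mh C0 h0 hneg.
have rh0 r : (0 <= r * h r)%R.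
  by have [r0|/ltW r0] := leP r 0%R; [rewrite hneg// mulr0|rewrite mulr_ge0].
pose F (z : R * R) := (C z.2 * (z.1 * h (z.1 * Num.sqrt (1 + z.2 ^+ 2))))%:E.
have s0 (u : R) : (0 < Num.sqrt (1 + u ^+ 2))%R.
  by rewrite sqrtr_gt0 ltr_wpDr// sqr_ge0.
have F0 z : 0 <= F z.
  rewrite lee_fin mulr_ge0//.
  have [r0|/ltW r0] := leP z.1 0%R; last by rewrite mulr_ge0.
  by rewrite hneg ?mulr0// mulr_le0_ge0// ltW.
have ms : measurable_fun setT (fun u : R => Num.sqrt (1 + u ^+ 2)).
  apply: measurableT_comp; first exact: continuous_measurable_fun (@sqrt_continuous R).
  by apply: measurable_funD => //; exact: exprn_measurable.
have mF : measurable_fun setT F.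
  apply/measurable_EFinP; apply: measurable_funM.
    exact: measurableT_comp.
  apply: measurable_funM => //; apply: measurableT_comp => //.
  apply: measurable_funM => //; exact: (measurableT_comp ms).
transitivity (\int[mu]_x \int[mu]_u F (x, u)).
  apply: eq_integral => x _; have [x0|x0] := leP x 0%R.
    rewrite mule0 integral0_eq// => u _; rewrite /F /= hneg ?mulr0//.
    by rewrite mulr_le0_ge0// ltW.
  rewrite mule1 (ge0_integral_scale _ _ x0); last 2 first.
  - apply/measurable_EFinP; apply: measurable_funM.
      by apply: measurableT_comp => //; exact: mulrr_measurable.
    apply: measurableT_comp => //; apply: measurableT_comp.
      exact: continuous_measurable_fun (@sqrt_continuous R).
    by apply: measurable_funD => //; exact: exprn_measurable.
  - by move=> y; rewrite lee_fin mulr_ge0.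
  rewrite -ge0_integralZl_EFin//; last 3 first.
  - by move=> y _; rewrite lee_fin mulr_ge0.
  - apply/measurable_EFinP; apply: measurable_funM.
      by apply: measurableT_comp => //; apply: measurable_funM => //;
        exact: mulrl_measurable.
    apply: measurableT_comp => //; apply: measurableT_comp.
      exact: continuous_measurable_fun (@sqrt_continuous R).
    apply: measurable_funD => //; apply: measurable_funX; exact: mulrl_measurable.
  - exact: ltW.
  apply: eq_integral => u _; rewrite -EFinM /F /=; congr EFin.
  have -> : (x * u / x = u)%R by field; rewrite gt_eqF.
  have -> : (x ^+ 2 + (x * u) ^+ 2 = x ^+ 2 * (1 + u ^+ 2))%R by ring.
  by rewrite sqrtrM ?sqr_ge0// sqrtr_sqr gtr0_norm// mulrCA.
have -> := @fubini_tonelli _ _ (measurableTypeR R) (measurableTypeR R) R mu mu F mF F0.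
have mrh : measurable_fun setT (fun r : R => (r * h r)%:E).
  by apply/measurable_EFinP; apply: measurable_funM.
have H0 : 0 <= \int[mu]_r (r * h r)%:E.
  by apply: integral_ge0 => r _; rewrite lee_fin.
rewrite -ge0_integralZr//; last 2 first.
- apply/measurable_EFinP; apply: measurable_funM => //.
  apply: continuous_measurable_fun; exact: (@continuous_oneDsqrV R).
- move=> u _; rewrite lee_fin divr_ge0// addr_ge0// sqr_ge0//.
apply: eq_integral => u _.
rewrite (ge0_integral_scale _ _ (s0 u) mrh); last by move=> r; rewrite lee_fin.
rewrite /F /=.
under eq_integral do rewrite EFinM.
rewrite ge0_integralZl//; last 3 first.
- by apply/measurable_EFinP; apply: measurable_funM => //; apply: measurableT_comp => //;
  exact: mulrr_measurable.
- move=> x _; have := F0 (x, 0%R); rewrite !lee_fin /F/= => _.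
  by rewrite -(pmulr_rge0 _ (s0 u)) mulrA; rewrite [X in (X * _)%R]mulrC rh0.
- by rewrite lee_fin.
under [in RHS]eq_integral do rewrite -mulrA EFinM [X in h X]mulrC.
rewrite ge0_integralZl//; last 2 first.
- by apply/measurable_EFinP; apply: measurable_funM => //; apply: measurableT_comp => //;
  exact: mulrr_measurable.
- move=> x _; rewrite lee_fin.
  by rewrite -(pmulr_rge0 _ (s0 u)) mulrA; rewrite [X in (X * _)%R]mulrC rh0.
rewrite !muleA -!EFinM; congr (_%:E * _).
rewrite -mulrA -expr2 sqr_sqrtr ?mulrVK// ?unitfE.
- by rewrite gt_eqF// ltr_wpDr// sqr_ge0.
- by rewrite addr_ge0// sqr_ge0.
Qed.

(** Both coordinates are folded before polar coordinates enter, so f itself need not split into an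
    angular and a radial factor; only its sum over the four reflections must. *)
Lemma ge0_integral_polar (f : R * R -> R) (C h : R -> R) :
  measurable_fun setT f -> (forall z, 0 <= f z)%R ->
  measurable_fun setT C -> measurable_fun setT h ->
  (forall u : R, 0 <= C u)%R -> (forall r : R, 0 <= h r)%R ->
  (forall u : R, u <= 0 -> C u = 0)%R -> (forall r : R, r <= 0 -> h r = 0)%R ->
  (forall x y : R, 0 < x -> 0 < y ->
    f (x, y) + f (- x, y) + (f (x, - y) + f (- x, - y)) =
    C (y / x) * h (Num.sqrt (x ^+ 2 + y ^+ 2)))%R ->
  \int[mu \x mu]_z (f z)%:E =
  \int[mu]_u (C u / (1 + u ^+ 2))%:E * \int[mu]_r (r * h r)%:E.
Proof.
move=> mf f0 mC mh C0 h0 Cneg hneg fold.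
rewrite -ge0_integral_quadrant// (@fubini_tonelli1 _ _ (measurableTypeR R)
  (measurableTypeR R) R mu mu (EFin \o f))//; last first.
  exact/measurable_EFinP.
rewrite ge0_integral_setT_fold; last 2 first.
- apply: measurable_fun_fubini_tonelli_F => //; exact/measurable_EFinP.
- by move=> x; apply: integral_ge0 => y _; rewrite lee_fin.
have mx (x : R) : measurable_fun setT (fun y : R => (f (x, y))%:E).
  apply/measurable_EFinP; exact: measurableT_comp.
apply: eq_integral => x _; have [x0|x0] := leP x 0%R; first by rewrite !mule0.
have mN (y : R) : 0 <= (f (x, y))%:E by rewrite lee_fin.
have mN2 (y : R) : 0 <= (f (- x, y)%R)%:E by rewrite lee_fin.
congr (_ * _); rewrite /fubini_F.
rewrite -(ge0_integralD mu measurableT (fun y _ => mN y) (mx x) (fun y _ =>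
  mN2 y) (mx (- x)%R)).

rewrite ge0_integral_setT_fold; last 2 first.
- by apply: emeasurable_funD; exact: mx.
- by move=> y; rewrite -EFinD lee_fin addr_ge0.
apply: eq_integral => y _; have [y0|y0] := leP y 0%R.
  by rewrite mule0 Cneg ?mul0r// mulr_le0_ge0// invr_ge0 ltW.
by rewrite mule1 -!EFinD /= fold.
Qed.

End polar.

(** * Integrals of (1 + t^2)^-(n+1) over half-lines *)

Section wallis.
Context {R : realType}.
Let mu := @lebesgue_measure R.

Lemma ge0_FTC2y (f F : R -> R) (a l : R) :
  (forall x, a <= x -> 0 <= f x) -> continuous f ->
  (forall x : R, is_derive x 1 F (f x)) -> F x @[x --> +oo] --> l ->
  (\int[mu]_(x in `[a, +oo[) (f x)%:E = (l - F a)%:E)%E.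
Proof.
move=> f0 cf dF Fl.
rewrite (@ge0_continuous_FTC2y _ f F a l)//.
- exact: continuous_subspaceT.
- apply: cvg_at_right_filter; apply: differentiable_continuous.
  by apply/derivable1_diffP; case: (dF a).
- by move=> x _; rewrite derive1E; case: (dF x).
Qed.

Lemma cvgy_inv : (x : R)^-1 @[x --> +oo] --> (0 : R).
Proof.
apply/gtr0_cvgV0; last exact: cvg_id.
exact: nbhs_pinfty_gt.
Qed.

(** For N = 2 n the exponent N / 2 + 1 in [tau] is n + 1, so this is its integrand without real
    powers. *)
Definition invD (n : nat) (t : R) : R := ((1 + t ^+ 2) ^+ n.+1)^-1.

(* The recursion in n comes from differentiating t (1 + t^2)^-n. *)
Fixpoint invD_prim (n : nat) (t : R) : R :=
  if n is m.+1 then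
    t * ((2 * m.+1%:R)^-1 * invD m t) +
    (2 * m%:R + 1) / (2 * m.+1%:R) * invD_prim m t
  else atan t.

(* Integral of (1 + t^2)^-(n+1) over the positive half-line. *)
Fixpoint wallis (n : nat) : R :=
  if n is m.+1 then (2 * m%:R + 1) / (2 * m.+1%:R) * wallis m else pi / 2.

Lemma is_derive1X (f : R -> R) (n : nat) (x df : R) : is_derive x 1 f df ->
  is_derive x 1 (fun t => f t ^+ n) (n%:R * f x ^+ n.-1 * df).
Proof.
move=> dfx; have -> : (fun t => f t ^+ n) = f ^+ n by rewrite exprfctE.
exact: is_deriveX.
Qed.

Lemma oneDsqr_gt0 (t : R) : 0 < 1 + t ^+ 2.
Proof. by rewrite ltr_wpDr// sqr_ge0. Qed.

Lemma invD_gt0 n (t : R) : 0 < invD n t.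
Proof. by rewrite invr_gt0 exprn_gt0// oneDsqr_gt0. Qed.

Lemma is_derive_invD n (t : R) :
  is_derive t 1 (invD n) (- (2 * n.+1%:R) * (t * invD n.+1 t)).
Proof.
have t0 := oneDsqr_gt0 t.
have d1 : is_derive t 1 (fun t : R => 1 + t ^+ 2) (2 * t).
  apply: is_derive_eq.
  rewrite add0r /GRing.scale /=; ring.
have := @is_deriveV R (fun t : R => (1 + t ^+ 2) ^+ n.+1) t _ 1 _
  (is_derive1X _ n.+1 _ _ d1).
move=> /(_ (lt0r_neq0 (exprn_gt0 _ t0))) d2.
apply: (is_derive_eq d2).
rewrite /invD /= /GRing.scale /=.
move: t0; set a := 1 + t ^+ 2 => a0; rewrite !(exprS a).
field; rewrite expf_neq0 ?gt_eqF//.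
Qed.

Lemma continuous_invD n : continuous (invD n).
Proof.
move=> t; apply: differentiable_continuous; apply/derivable1_diffP.
by case: (is_derive_invD n t).
Qed.

Lemma is_derive_invD_prim n (t : R) : is_derive t 1 (invD_prim n) (invD n t).
Proof.
have t0 := oneDsqr_gt0 t.
elim: n => [|n IH].
  rewrite /invD expr1; exact: is_derive1_atan.
have dn := is_derive_invD n t.
rewrite /invD_prim -/invD_prim.
apply: is_derive_eq.
rewrite /GRing.scale /= /invD.
(* Eliminating t^2 in favour of a = 1 + t^2 leaves a rational identity in a and its powers. *)
have e : t ^+ 2 = (1 + t ^+ 2) - 1 by ring.
move: t0 e; set a := 1 + t ^+ 2 => a0 e; rewrite !(exprS a).
rewrite !mulrA -!expr2.
have n0 : 2 * n.+1%:R != 0 :> R by rewrite mulf_neq0 ?pnatr_eq0.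
have -> : t / (2 * n.+1%:R) * - (2 * n.+1%:R) * t = - (a - 1).
  by rewrite -e; field; rewrite ?[_ + n%:R]addrC natr1 pnatr_eq0.
field; rewrite ?expf_neq0 ?gt_eqF//=.
Qed.

Lemma invD_prim0 n : invD_prim n 0 = 0.
Proof. by elim: n => [|n IH]; rewrite /= ?atan0// IH mulr0 mul0r addr0. Qed.

(** Since x^2 (1 + x^2)^-(n+1) <= 1, the boundary term of the recursion is at most 1 / x, and only
    the multiple of the previous integral survives. *)
Lemma cvg_invD_prim n : invD_prim n x @[x --> +oo%R] --> wallis n.
Proof.
elim: n => [|n IH]; first exact: cvgy_atan.
rewrite /invD_prim -/invD_prim /wallis -/wallis.
rewrite -[X in _ --> X]add0r; apply: cvgD; last exact: cvgMr.
apply: (@squeeze_cvgr _ _ _ _ (fun=> 0) (fun x : R => x^-1)).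
- near=> x.
  have x0 : 0 < x by near: x; exact: nbhs_pinfty_gt.
  have i0 := invD_gt0 n x.
  apply/andP; split; first by apply: mulr_ge0; [exact: ltW|apply: mulr_ge0;
    [rewrite invr_ge0; exact: mulr_ge0|exact: ltW]].
  rewrite -[x^-1]mul1r ler_pdivlMr// mulrAC -expr2 mulrCA.
  have : x ^+ 2 * invD n x <= 1.
    rewrite /invD ler_pdivrMr ?exprn_gt0 ?oneDsqr_gt0// mul1r.
    apply: (@le_trans _ _ (1 + x ^+ 2)); first by rewrite lerDr.
    rewrite [leRHS]exprS ler_peMr ?(ltW (oneDsqr_gt0 _))//.
    by rewrite exprn_ege1// lerDl sqr_ge0.
  rewrite mulrA [X in X * _ <= _]mulrC -mulrA => h.
  apply: (le_trans _ h); rewrite ler_piMl//.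
    by rewrite mulr_ge0 ?sqr_ge0 ?(ltW i0).
  by rewrite invf_le1 ?mulr_gt0// -natrM ler1n.
- exact: cvg_cst.
- exact: cvgy_inv.
Unshelve. all: by end_near. Qed.

Lemma integral_invD n (a : R) :
  (\int[mu]_(x in `[a, +oo[) (invD n x)%:E = (wallis n - invD_prim n a)%:E)%E.
Proof.
apply: ge0_FTC2y.
- by move=> x _; exact/ltW/invD_gt0.
- exact: continuous_invD.
- exact: is_derive_invD_prim.
- exact: cvg_invD_prim.
Qed.

End wallis.

(** * Gamma at integers and half-integers *)

Section gamma.
Context {R : realType}.
Let mu := @lebesgue_measure R.

(** Repeated integration by parts of x^n exp(-x), with the constant fixed so that the limit at
    infinity is 0. *)
Fixpoint gamma_prim (n : nat) (x : R) : R :=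
  if n is m.+1 then m.+1%:R * gamma_prim m x - x ^+ m.+1 * expR (- x)
  else - expR (- x).

Lemma is_derive_expRN (x : R) : is_derive x 1 (fun x : R => expR (- x)) (- expR (- x)).
Proof.
have h : is_derive x 1 (-%R : R -> R) (-1) by apply: is_derive_eq.
apply: (is_derive_eq (is_derive1_comp (is_derive_expR (- x)) h)).
by rewrite mulrN1.
Qed.

Lemma is_derive_gamma_prim n (x : R) :
  is_derive x 1 (gamma_prim n) (x ^+ n * expR (- x)).
Proof.
have h := is_derive_expRN x.
elim: n => [|n IH].
  rewrite /gamma_prim; apply: is_derive_eq; by rewrite expr0 mul1r opprK.
have hX := is_derive1X _ n.+1 _ _ (is_derive_id x (1 : R)).
rewrite /gamma_prim -/gamma_prim.
apply: is_derive_eq; rewrite /GRing.scale /=.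
ring.
Qed.

Lemma cvg_exprn_expRN n : x ^+ n * expR (- x) @[x --> +oo%R] --> (0 : R).
Proof.
apply: (@squeeze_cvgr _ _ _ _ (fun=> 0) (fun x : R => n.+1`!%:R * x^-1)).
- near=> x.
  have x0 : 0 < x by near: x; exact: nbhs_pinfty_gt.
  apply/andP; split; first by rewrite mulr_ge0 ?expR_ge0 ?exprn_ge0 ?(ltW x0).
  (* A single term of the exponential series, x^(n+1) / (n+1)!, beats x^n by a factor x. *)
  have := expR_ge1Dxn n (ltW x0).
  rewrite expRN ler_pdivrMr ?expR_gt0// => h.
  rewrite mulrAC ler_pdivlMr// -exprSr.
  rewrite -ler_pdivrMl ?ltr0n ?fact_gt0// mulrC.
  by apply: le_trans h; rewrite lerDr.
- exact: cvg_cst.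
- by rewrite -[X in _ --> X](mulr0 n.+1`!%:R); apply: cvgMr; exact: cvgy_inv.
Unshelve. all: by end_near. Qed.

Lemma cvg_gamma_prim n : gamma_prim n x @[x --> +oo%R] --> (0 : R).
Proof.
elim: n => [|n IH].
  rewrite -oppr0; apply: cvgN; exact: cvgr_expR.
rewrite /gamma_prim -/gamma_prim.
rewrite -[X in _ --> X](subrr 0); apply: cvgB; last exact: cvg_exprn_expRN.
rewrite -[X in _ --> X](mulr0 n.+1%:R); exact: cvgMr.
Qed.

Lemma gamma_prim0 n : gamma_prim n 0 = - n`!%:R.
Proof.
elim: n => [|n IH]; rewrite /gamma_prim -/gamma_prim; first by rewrite oppr0 expR0.
by rewrite IH expr0n mul0r subr0 mulrN -natrM.
Qed.

Lemma integral_exprn_expRN (n : nat) :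
  (\int[mu]_(x in `]0%R, +oo[) (x ^+ n * expR (- x))%:E = n`!%:R%:E)%E.
Proof.
have c : continuous (fun x : R => x ^+ n * expR (- x)).
  move=> x; apply: cvgM; first exact: exprn_continuous.
  apply: (@continuous_comp _ _ _ -%R expR); first exact: opp_continuous.
  exact: continuous_expR.
rewrite integral_itv_obnd_cbnd; last first.
  apply/measurable_EFinP; apply: measurable_funTS; exact: continuous_measurable_fun.
have f0 (x : R) : 0 <= x -> 0 <= x ^+ n * expR (- x).
  by move=> x0; rewrite mulr_ge0 ?expR_ge0 ?exprn_ge0.
have -> := ge0_FTC2y _ (gamma_prim n) 0 0 f0 c (is_derive_gamma_prim n) (cvg_gamma_prim
  n).
by rewrite gamma_prim0 sub0r opprK.
Qed.

Lemma Gamma_natE n : Gamma (n%:R + 1 : R) = n`!%:R.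
Proof.
rewrite /Gamma /Rintegral; rewrite -[RHS]/(fine n`!%:R%:E) -integral_exprn_expRN.
congr fine; apply: eq_integral => x; rewrite inE/= in_itv/= andbT => x0.
by rewrite addrK powR_mulrn// ltW.
Qed.

Lemma integralT_invD n :
  (\int[mu]_x (invD n x)%:E = (2 * wallis n)%:E)%E.
Proof.
rewrite ge0_symfun_integralT//.
- by rewrite -set_itvcy integral_invD invD_prim0 subr0.
- by move=> x; exact/ltW/invD_gt0.
- exact: continuous_invD.
- by move=> x; rewrite /invD /= sqrrN.
Qed.

(* Both sides are the double integral of y^n exp(-y (1 + t^2)) over y > 0. *)
Lemma Gamma_half n :
  2 * n`!%:R * wallis n = Num.sqrt pi * Gamma (n%:R + 2^-1 : R).
Proof.
pose F (z : R * R) : R := (0 < z.2)%R%:R * (z.2 ^+ n * expR (- (z.2 * (1 + z.1 ^+ 2)))).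
have F0 z : 0 <= F z.
  rewrite /F; have [h|h] := leP z.2 0; first by rewrite mul0r.
  by rewrite mul1r mulr_ge0 ?expR_ge0 ?exprn_ge0 ?(ltW h).
have mI : measurable_fun setT (fun y : R => (0 < y)%R%:R : R).
  by apply: measurableT_comp => //; exact: measurable_fun_ltr.
have mF : measurable_fun setT F.
  apply: measurable_funM; first exact: (measurableT_comp mI).
  apply: measurable_funM; first exact: measurable_funX.
  apply: measurableT_comp => //; apply: measurableT_comp => //.
  apply: measurable_funM => //; apply: measurable_funD => //.
  exact: measurable_funX.
have mgy : measurable_fun setT (fun y : R => (0 < y)%R%:R * (y ^+ n * expR (- y)) : R).
  apply: measurable_funM => //; apply: measurable_funM; first exact: exprn_measurable.
  by apply: measurableT_comp => //; exact: oppr_measurable.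
have gy0 (y : R) : 0 <= (0 < y)%R%:R * (y ^+ n * expR (- y)).
  have [h|h] := leP y 0; first by rewrite mul0r.
  by rewrite mul1r mulr_ge0 ?expR_ge0 ?exprn_ge0 ?(ltW h).
have gyE : (\int[mu]_y ((0 < y)%R%:R * (y ^+ n * expR (- y)))%:E = n`!%:R%:E)%E.
  rewrite -integral_exprn_expRN [RHS]integral_mkcond; apply: eq_integral => y _.
  rewrite patchE mem_setE in_itv/= andbT; case: ifP => _; by rewrite ?mul1r ?mul0r.
have E1 : (\int[mu]_t \int[mu]_y (F (t, y))%:E = (2 * n`!%:R * wallis n)%:E)%E.
  transitivity (\int[mu]_t (n`!%:R%:E * (invD n t)%:E))%E.
    apply: eq_integral => t _.
    have a0 := oneDsqr_gt0 t.
    have a0' : 0 < (1 + t ^+ 2)^-1 by rewrite invr_gt0.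
    (* Scaling y by 1 / (1 + t^2) turns the inner integral into n! (1 + t^2)^-(n+1). *)
    rewrite (ge0_integral_scale _ _ a0'); last 2 first.
    - by apply/measurable_EFinP; exact: measurableT_comp.
    - by move=> y; rewrite lee_fin.
    under eq_integral => y _.
      have -> : F (t, (1 + t ^+ 2)^-1 * y) = (1 + t ^+ 2)^-1 ^+ n * ((0 < y)%R%:R * (y ^+
        n * expR (- y))).
        rewrite /F /= pmulr_rgt0// exprMn [_^-1 * y * _]mulrAC mulVf ?gt_eqF// mul1r.
        by rewrite !mulrA [_ ^+ n * _%:R]mulrC.
      rewrite EFinM; over.
    rewrite ge0_integralZl//; last 3 first.
    - exact/measurable_EFinP.
    - by move=> y _; rewrite lee_fin.
    - by rewrite lee_fin exprn_ge0// ltW.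
    rewrite gyE -!EFinM /invD; congr EFin.
    by rewrite mulrA -exprS exprVn mulrC.
  rewrite ge0_integralZl//; last 2 first.
  - by apply/measurable_EFinP; apply: continuous_measurable_fun; exact: continuous_invD.
  - by move=> t _; rewrite lee_fin; exact/ltW/invD_gt0.
  by rewrite integralT_invD -EFinM; congr EFin; ring.
have E2 : (\int[mu]_y \int[mu]_t (F (t, y))%:E =
    (Num.sqrt pi)%:E * \int[mu]_(y in `]0%R, +oo[) (y `^ (n%:R + 2^-1 - 1) * expR (-
      y))%:E)%E.
  rewrite -ge0_integralZl//; last 2 first.
  - apply/measurable_EFinP; apply: measurable_funTS; apply: measurable_funM;
    first exact: measurable_powR.
    by apply: measurableT_comp => //; exact: oppr_measurable.
  - by move=> y _; rewrite lee_fin mulr_ge0 ?expR_ge0 ?powR_ge0.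
  rewrite [RHS]integral_mkcond; apply: eq_integral => y _.
  rewrite patchE mem_setE in_itv/= andbT.
  have [y0|y0] := leP y 0.
    by rewrite integral0_eq// => t _; rewrite /F /= ltNge y0 mul0r.
  have c0 : 0 < (Num.sqrt y)^-1 by rewrite invr_gt0 sqrtr_gt0.
  (* Scaling t by 1 / sqrt(y) leaves a Gaussian integral in t; the factor 1 / sqrt(y) lowers y^n to
     y^(n - 1/2). *)
  rewrite (ge0_integral_scale _ _ c0); last 2 first.
  - by apply/measurable_EFinP; exact: measurableT_comp.
  - by move=> t; rewrite lee_fin.
  under eq_integral => t _.
    have -> : F ((Num.sqrt y)^-1 * t, y) = (y ^+ n * expR (- y)) * gauss_fun t.
      rewrite /F /= y0 mul1r -mulrA -expRD /gauss_fun; congr (_ * expR _).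
      rewrite exprMn exprVn sqr_sqrtr ?(ltW y0)// mulrDr mulr1 mulrA divff ?gt_eqF//.
      by rewrite mul1r opprD.
    rewrite EFinM; over.
  rewrite ge0_integralZl//; last 3 first.
  - by apply/measurable_EFinP; exact: measurable_gauss_fun.
  - by move=> t _; rewrite lee_fin gauss_fun_ge0.
  - by rewrite lee_fin mulr_ge0 ?expR_ge0 ?exprn_ge0 ?(ltW y0).
  rewrite integralT_gauss -!EFinM; congr EFin.
  have -> : n%:R + 2^-1 - 1 = n%:R - 2^-1 :> R by field.
  rewrite powRD; last by apply/implyP => _; rewrite gt_eqF.
  rewrite powRN powR12_sqrt ?(ltW y0)// powR_mulrn ?(ltW y0)//.
  ring.
have EQ : (\int[mu]_t \int[mu]_y (F (t, y))%:E = \int[mu]_y \int[mu]_t (F (t, y))%:E)%E.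
  apply: (@fubini_tonelli _ _ (measurableTypeR R) (measurableTypeR R) R mu mu (EFin \o
    F)).
    exact/measurable_EFinP.
  by move=> z; rewrite lee_fin.
move: EQ; rewrite E1 E2 /Gamma /Rintegral.
(* [Gamma] takes the finite part of this integral, so the value +oo has to be excluded: it would
   make one side of the Tonelli equation infinite while the other is finite. *)
have : (0 <= \int[mu]_(y in `]0%R, +oo[) (y `^ (n%:R + 2^-1 - 1) * expR (- y))%:E)%E.
  by apply: integral_ge0 => y _; rewrite lee_fin mulr_ge0 ?expR_ge0 ?powR_ge0.
have sp : 0 < Num.sqrt (pi : R) by rewrite sqrtr_gt0 pi_gt0.
case: (\int[mu]_(y in _) _)%E => [r _|_|//]; first by rewrite -EFinM => -[].
by rewrite gt0_muley// lte_fin.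
Qed.

End gamma.

(** * The radial integral of the beta product *)

Section radial.
Context {R : realType}.
Let mu := @lebesgue_measure R.

(** The recursion reflects (1 - u)^(q+1) = (1 - u)^q - u (1 - u)^q. *)
Fixpoint beta_prim (q p : nat) (u : R) : R :=
  if q is q'.+1 then beta_prim q' p u - beta_prim q' p.+1 u
  else u ^+ p.+1 / p.+1%:R.

Lemma is_derive_beta_prim q p (u : R) :
  is_derive u 1 (beta_prim q p) (u ^+ p * (1 - u) ^+ q).
Proof.
elim: q p => [|q IH] p.
  have h := is_derive1X _ p.+1 _ _ (is_derive_id u (1 : R)).
  rewrite /beta_prim; apply: is_derive_eq.
  rewrite /GRing.scale /= expr0 !mulr1 !mulr0 add0r mulrA.
  by rewrite mulVf ?mul1r ?pnatr_eq0.
have h1 := IH p; have h2 := IH p.+1.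
rewrite /beta_prim -/beta_prim; apply: is_derive_eq.
by rewrite !exprS; ring.
Qed.

Lemma beta_prim0 q p : beta_prim q p 0 = 0.
Proof.
elim: q p => [|q IH] p; first by rewrite /= expr0n mul0r.
by rewrite /= !IH subrr.
Qed.

(** Over the denominator (p + q + 2)! the recursion reads p! q! ((p + q + 2) - (p + 1)) = p! (q +
    1)!. *)
Lemma beta_prim1 q p : beta_prim q p 1 = p`!%:R * q`!%:R / (p + q).+1`!%:R.
Proof.
have f0 m : m`!%:R != 0 :> R by rewrite pnatr_eq0 -lt0n fact_gt0.
have s0 m : m.+1%:R != 0 :> R by rewrite pnatr_eq0.
elim: q p => [|q IH] p.
  rewrite /= expr1n addn0 factS natrM fact0; field.
  by rewrite f0 addrC natr1 s0.
rewrite /beta_prim -/beta_prim !IH addSn addnS [(p + q).+2`!]factS [p.+1`!]factS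
  [q.+1`!]factS.
have := s0 (p + q).+1; have := f0 (p + q).+1.
move: ((p + q).+1`!) (p`!) (q`!) => a b c a0; rewrite !natrM.
rewrite -[_.+2%:R]natr1 -[(p + q).+1%:R]natr1 natrD -!natr1 => s1.
field; rewrite a0 /=.
by rewrite s1.
Qed.

(* The integral in tau at modulus r < 1, for N = 2 n. *)
Definition tail (n : nat) (r : R) : R := wallis n - invD_prim n ((r^-1 - r) / 2).

Definition dtail (n : nat) (r : R) : R := 2 * (2 * r) ^+ (2 * n) / (1 + r ^+ 2) ^+ (2 *
  n).+1.

Lemma tail_ge0 n (r : R) : 0 <= tail n r.
Proof.
rewrite -lee_fin /tail -integral_invD; apply: integral_ge0 => x _.
by rewrite lee_fin; exact/ltW/invD_gt0.
Qed.

Lemma tail1 n : tail n 1 = wallis n.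
Proof. by rewrite /tail invr1 subrr mul0r invD_prim0 subr0. Qed.

(** With s = (1/r - r) / 2, the sum 1 + s^2 is the perfect square ((1 + r^2) / (2 r))^2, so the
    derivative is a monomial over a power of 1 + r^2. *)
Lemma is_derive_tail n (r : R) : 0 < r -> is_derive r 1 (tail n) (dtail n r).
Proof.
move=> r0; have rn0 : r != 0 by rewrite gt_eqF.
have dV := @is_deriveV R id r 1 1 rn0 (is_derive_id r (1 : R)).
have dT : is_derive r 1 (fun r : R => (r^-1 - r) / 2) (- (1 + r ^- 2) / 2).
  apply: is_derive_eq; rewrite /GRing.scale /=; field.
  by rewrite rn0.
have := is_derive1_comp (is_derive_invD_prim n _) dT.
rewrite /tail => dP.
apply: (is_derive_eq (is_deriveB (is_derive_cst (wallis n) r (1 : R)) dP)).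
rewrite sub0r /dtail /invD.
have a0 := oneDsqr_gt0 r.
have -> : 1 + ((r^-1 - r) / 2) ^+ 2 = ((1 + r ^+ 2) / (2 * r)) ^+ 2 by field.
have b0 : 2 * r != 0 by rewrite mulf_neq0.
rewrite -exprM mulnS !expr_div_n; move: (2 * n)%N => m.
have -> : 1 + r ^- 2 = (1 + r ^+ 2) * 2 * 2/ (2 * r) ^+ 2 by field.
rewrite -[m.+1]addn1 !exprD expr1.
move: a0; set a := 1 + r ^+ 2 => a0.
have A0 : a ^+ m != 0 by rewrite expf_neq0// gt_eqF.
have B0 : (2 * r) ^+ m != 0 by rewrite expf_neq0.
move: A0 B0; set A := a ^+ m; set B := (2 * r) ^+ m => A0 B0.
by field; rewrite ?A0 ?B0 ?rn0 ?gt_eqF.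
Qed.

Lemma cvg_tail n : tail n r @[r --> 0^'+] --> 0.
Proof.
rewrite /tail -[X in _ --> X](subrr (wallis n)); apply: cvgB; first exact: cvg_cst.
apply: (@cvg_comp _ _ _ (fun r : R => (r^-1 - r) / 2) (invD_prim n) _ +oo);
  last exact: cvg_invD_prim.
have h : (fun r : R => r^-1) r @[r --> 0^'+] --> +oo.
  apply/(cvgrVy (f := id)); first exact: nbhs_right_gt.
  exact: (cvg_at_right_filter cvg_id).
apply/cvgryPge => A; near=> r.
(* For r < 1, the bound 1/r >= 2 A + 1 gives (1/r - r) / 2 >= A. *)
have h3 : 2 * A + 1 <= r^-1 by near: r; move/cvgryPge: h; exact.
have h4 : r < 1 by near: r; exact: nbhs_right_lt.
have : (2 * A + 1 - 1) / 2 <= (r^-1 - r) / 2.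
  by rewrite ler_pM2r// lerB// ltW.
by rewrite addrK mulrAC divff ?mul1r.
Unshelve. all: by end_near. Qed.

(** This decay tames the singularity at the origin. By l'Hopital the ratio behaves like [dtail] over
    N r^(N-1), a constant times r (1 + r^2)^-(N+1). *)
Lemma cvg_tail_exprV n : tail n.+1 r / r ^+ (2 * n.+1) @[r --> 0^'+] --> 0.
Proof.
have [m e] : exists m, (2 * n.+1)%N = m.+2 by exists (2 * n)%N; rewrite mulnS.
rewrite e.
pose df (r : R) := 2 * (2 * r) ^+ m.+2 / (1 + r ^+ 2) ^+ m.+3.
pose dg (r : R) := m.+2%:R * r ^+ m.+1.
apply: (@lhopital_at_right R (tail n.+1) df (fun r => r ^+ m.+2) dg 0 1 0).
- exact: ltr01.
- move=> x; rewrite in_itv/= => /andP[x0 _]; have := is_derive_tail n.+1 _ x0.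
  by rewrite /dtail e.
- move=> x _; have := is_derive1X _ m.+2 _ _ (is_derive_id x (1 : R)).
  by rewrite mulr1.
- exact: cvg_tail.
- apply: cvg_at_right_filter; rewrite -[X in _ --> X](expr0n R m.+2).
  exact: exprn_continuous.
- move=> x; rewrite in_itv/= => /andP[x0 _].
  by rewrite /dg mulf_neq0 ?pnatr_eq0// expf_neq0 ?gt_eqF.
pose c : R := 2 * 2 ^+ m.+2 / m.+2%:R.
apply: (@cvg_trans _ ((fun r : R =>
  c * (r * ((1 + r ^+ 2) ^+ m.+3)^-1)) r @[r --> 0^'+])).
  apply: near_eq_cvg; near=> r.
  have r0 : 0 < r by near: r; exact: nbhs_right_gt.
  rewrite /c /df /dg exprMn [r ^+ m.+2]exprS.
  have A0 : (1 + r ^+ 2) ^+ m.+3 != 0 by rewrite expf_neq0// gt_eqF// oneDsqr_gt0.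
  have B0 : r ^+ m.+1 != 0 by rewrite expf_neq0// gt_eqF.
  have C0 : m.+2%:R != 0 :> R by rewrite pnatr_eq0.
  move: A0 B0 C0.
  move: ((1 + r ^+ 2) ^+ m.+3) (r ^+ m.+1) (m.+2%:R : R) (2 ^+ m.+2 : R) =>
    A B C D A0 B0 C0.
  by field; rewrite A0 B0 C0.
suff : (fun r : R => c * (r * ((1 + r ^+ 2) ^+ m.+3)^-1)) r @[r --> 0^'+] --> 0 by [].
rewrite -[X in _ --> X](mulr0 c); apply: cvgMr; apply: cvg_at_right_filter.
rewrite -[X in _ --> X](mul0r ((1 + (0:R) ^+ 2) ^+ m.+3)^-1); apply: cvgM;
  first exact: cvg_id.
apply: cvgV; first by rewrite expf_neq0// gt_eqF// oneDsqr_gt0.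
apply: (@continuous_comp _ _ _ (fun r : R => 1 + r ^+ 2) (fun x => x ^+ m.+3)).
  exact: continuous_oneDsqr.
exact: exprn_continuous.
Unshelve. all: by end_near. Qed.

(** Put v = r^2 / (1 + r^2), so that 1 - v = 1 / (1 + r^2) and v' = 2 r / (1 + r^2)^2. For N = 2 p +
    k + 1 the left side is (r^-k + r^k) G'(r), and the right side is a sum of two beta integrands in
    v, with the exponents p and p + k exchanged. *)
Lemma expr_half_sum (p k : nat) (r : R) : 0 < r ->
  let a := 1 + r ^+ 2 in
  (r ^- k + r ^+ k) * (2 * (2 * r) ^+ (2 * p + k).+1 / a ^+ (2 * p + k).+2) =
  2 ^+ (2 * p + k).+1 *
   ((r ^+ 2 / a) ^+ p * (a^-1) ^+ (p + k) + (a^-1) ^+ p * (r ^+ 2 / a) ^+ (p + k))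
   * (2 * r / a ^+ 2).
Proof.
move=> r0 a.
have a0 : a != 0 by rewrite gt_eqF// oneDsqr_gt0.
have rn0 : r != 0 by rewrite gt_eqF.
rewrite !expr_div_n !exprVn -!exprM [in r ^+ (2 * (p + k))]mulnDr.
rewrite exprMn -addnS -[X in a ^+ X]addnS !exprD !exprS expr0.
rewrite !expr0 !mulr1.
have A0 : a ^+ p != 0 by rewrite expf_neq0.
have B0 : a ^+ k != 0 by rewrite expf_neq0.
have C0 : r ^+ k != 0 by rewrite expf_neq0.
move: A0 B0 C0; move: (a ^+ p) (a ^+ k) (r ^+ k) (r ^+ p) (2 ^+ p : R) (2 ^+ k : R) =>
  A B C D E F A0 B0 C0.
by field; rewrite a0 A0 B0 C0.
Qed.

(* Antiderivative of r^-1 (r^-k - r^k) tail on ]0, 1[: integrate by parts, and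
   recognize the remaining integral as a beta integral in u = r^2 / (1 + r^2). *)
Definition rad_prim (p k : nat) (n : nat) (r : R) : R :=
  (2 ^+ (2 * n) * (beta_prim (p + k) p (r ^+ 2 / (1 + r ^+ 2)) -
                   beta_prim (p + k) p ((1 + r ^+ 2)^-1))
   - (r ^- k + r ^+ k) * tail n r) / k%:R.

Definition rad_fun (k n : nat) (r : R) : R :=
  r^-1 * (r ^- k - r ^+ k) * tail n r.

(** The two beta terms differentiate to the two summands of [expr_half_sum]: one is taken at v, the
    other at 1 - v with a minus sign that absorbs the derivative of 1 - v. Together they cancel the
    term in G'(r). *)
Lemma is_derive_rad_prim p k n (r : R) : 0 < r -> (0 < k)%N ->
  (2 * n = (2 * p + k).+1)%N ->
  is_derive r 1 (rad_prim p k n) (rad_fun k n r).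
Proof.
case: k => // k r0 _ e.
have rn0 : r != 0 by rewrite gt_eqF.
have a0 := oneDsqr_gt0 r.
have an0 : 1 + r ^+ 2 != 0 by rewrite gt_eqF.
have d1 : is_derive r 1 (fun t : R => 1 + t ^+ 2) (2 * r).
  by apply: is_derive_eq; rewrite add0r /GRing.scale /=; ring.
have d2 := @is_deriveV R (fun t => 1 + t ^+ 2) r _ 1 an0 d1.
have d3 : is_derive r 1 (fun t : R => t ^+ 2 / (1 + t ^+ 2)) (2 * r / (1 + r ^+ 2) ^+ 2).
  apply: is_derive_eq; rewrite /GRing.scale /=; field.
  by rewrite an0.
have b1 := is_derive1_comp (is_derive_beta_prim (p + k.+1) p _) d3.
have b2 := is_derive1_comp (is_derive_beta_prim (p + k.+1) p _) d2.
have dt := is_derive_tail n _ r0.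
have dk := is_derive1X _ k.+1 _ _ (is_derive_id r (1 : R)).
have rk0 : r ^+ k.+1 != 0 by rewrite expf_neq0.
have dkV := @is_deriveV R (fun r => r ^+ k.+1) r _ 1 rk0 dk.
have E : is_derive r 1 (fun r : R =>
  (2 ^+ (2 * n) * ((beta_prim (p + k.+1) p \o (fun r : R => r ^+ 2 / (1 + r ^+ 2))) r -
                   (beta_prim (p + k.+1) p \o (fun r : R => (1 + r ^+ 2)^-1)) r)
   - (r ^- k.+1 + r ^+ k.+1) * tail n r) / k.+1%:R) (rad_fun k.+1 n r).
  apply: is_derive_eq.
  rewrite /GRing.scale /= /rad_fun.
  have -> : 1 - r ^+ 2 / (1 + r ^+ 2) = (1 + r ^+ 2)^-1 by field.
  have -> : 1 - (1 + r ^+ 2)^-1 = r ^+ 2 / (1 + r ^+ 2) by field.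
  have := expr_half_sum p k.+1 _ r0; rewrite /= -e => K.
  have {}K : (r ^- k.+1 + r ^+ k.+1) * dtail n r = 2 ^+ (2 * n) *
   ((r ^+ 2 / (1 + r ^+ 2)) ^+ p * ((1 + r ^+ 2)^-1) ^+ (p + k.+1) +
    ((1 + r ^+ 2)^-1) ^+ p * (r ^+ 2 / (1 + r ^+ 2)) ^+ (p + k.+1))
   * (2 * r / (1 + r ^+ 2) ^+ 2) by rewrite -K /dtail mulrA.
  have k0 : k.+1%:R != 0 :> R by rewrite pnatr_eq0.
  have -> : - (1 + r ^+ 2) ^- 2 * (2 * r) = - (2 * r / (1 + r ^+ 2) ^+ 2) by rewrite
    mulNr mulrC.
  rewrite !mulr0 add0r mulrN opprK -mulrDl mulrA -K.
  rewrite !exprS; have c0 : r ^+ k != 0 by rewrite expf_neq0.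
  move: c0 k0; move: (r ^+ k) (k.+1%:R : R) (dtail n r) (tail n r) => C D E F c0 k0.
  by field; rewrite c0 k0 rn0.
exact: E.
Qed.

Lemma rad_fun_ge0 k n (r : R) : 0 < r < 1 -> 0 <= rad_fun k n r.
Proof.
move=> /andP[r0 r1]; rewrite mulr_ge0 ?tail_ge0// mulr_ge0 ?invr_ge0 ?(ltW r0)//.
rewrite subr_ge0 (@le_trans _ _ 1)// ?exprn_ile1 ?(ltW r0) ?(ltW r1)//.
by rewrite invf_ge1 ?exprn_gt0// exprn_ile1 ?(ltW r0) ?(ltW r1).
Qed.

Lemma rad_fun_le k l n (r : R) : 0 < r < 1 -> (k <= l)%N ->
  rad_fun k n r <= rad_fun l n r.
Proof.
move=> /andP[r0 r1] kl; rewrite ler_wpM2r ?tail_ge0// ler_wpM2l ?invr_ge0 ?(ltW r0)//.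
have h : r ^+ l <= r ^+ k by rewrite ler_wiXn2l ?(ltW r0) ?(ltW r1).
by rewrite lerB// lef_pV2 ?posrE ?exprn_gt0.
Qed.

(** Near 0 the function is at most G(r) / r^(k+1), and k + 1 <= N. *)
Lemma cvg_rad_fun k n : (k < 2 * n.+1)%N -> rad_fun k n.+1 r @[r --> 0^'+] --> 0.
Proof.
move=> kn.
apply: (@squeeze_cvgr _ _ _ _ (fun=> 0) (fun r => tail n.+1 r / r ^+ (2 * n.+1))).
- near=> r.
  have r0 : 0 < r by near: r; exact: nbhs_right_gt.
  have r1 : r < 1 by near: r; exact: nbhs_right_lt.
  rewrite rad_fun_ge0 ?r0//= /rad_fun mulrC ler_wpM2l ?tail_ge0//.
  rewrite (@le_trans _ _ (r^-1 * r ^- k))//.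
    by rewrite ler_wpM2l ?invr_ge0 ?(ltW r0)// gerBl exprn_ge0// ltW.
  rewrite -invfM -exprS lef_pV2 ?posrE ?exprn_gt0//.
  by rewrite ler_wiXn2l ?(ltW r0) ?(ltW r1).
- exact: cvg_cst.
- exact: cvg_tail_exprV.
Unshelve. all: by end_near. Qed.

Lemma cvg_rad_prim p k n : (0 < k)%N -> (2 * n.+1 = (2 * p + k).+1)%N ->
  rad_prim p k n.+1 r @[r --> 0^'+] --> rad_prim p k n.+1 0.
Proof.
move=> k0 e; rewrite /rad_prim; apply: cvgMl.
have d (x : R) : {for x, continuous (beta_prim (p + k) p)}.
  apply: differentiable_continuous; apply/derivable1_diffP.
  by case: (is_derive_beta_prim (p + k) p x).
have cV : continuous (fun r : R => (1 + r ^+ 2)^-1) by exact: (@continuous_oneDsqrV R).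
apply: cvgB.
  apply: cvgMr; apply: cvgB; apply: cvg_at_right_filter.
    apply: (@continuous_comp _ _ _ (fun r : R => r ^+ 2 / (1 + r ^+ 2))); last exact: d.
    apply: cvgM; [exact: exprn_continuous|exact: cV].
  apply: (@continuous_comp _ _ _ (fun r : R => (1 + r ^+ 2)^-1)); last exact: d.
  exact: cV.
(* Inversion sends 0 to 0, so for k > 0 the factor r^-k + r^k is 0 at r = 0. The boundary term there
   thus agrees with its limit, as it is at most 2 G(r) / r^N near 0. *)
rewrite [X in X * tail _ _](_ : _ = 0) ?mul0r; last first.
  by rewrite !expr0n gtn_eqF// invr0 addr0.
apply: (@squeeze_cvgr _ _ _ _ (fun=> 0) (fun r => 2 * (tail n.+1 r / r ^+ (2 * n.+1)))).
- near=> r.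
  have r0 : 0 < r by near: r; exact: nbhs_right_gt.
  have r1 : r < 1 by near: r; exact: nbhs_right_lt.
  rewrite mulr_ge0 ?tail_ge0 ?addr_ge0 ?invr_ge0 ?exprn_ge0 ?(ltW r0)//=.
  rewrite mulrCA mulrC ler_wpM2l ?tail_ge0// mulr_natl mulr2n.
  have h : r ^- k <= r ^- (2 * n.+1).
    rewrite lef_pV2 ?posrE ?exprn_gt0// ler_wiXn2l ?(ltW r0) ?(ltW r1)//.
    by rewrite e (leq_trans (leq_addl _ _) (leqnSn _)).
  rewrite lerD// (le_trans _ h)// (@le_trans _ _ 1)//.
    by rewrite exprn_ile1 ?(ltW r0) ?(ltW r1).
  by rewrite invf_ge1 ?exprn_gt0// exprn_ile1 ?(ltW r0) ?(ltW r1).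
- exact: cvg_cst.
- rewrite -[X in _ --> X](mulr0 2); apply: cvgMr; exact: cvg_tail_exprV.
Unshelve. all: by end_near. Qed.

Lemma continuous_rad_fun k n (r : R) : 0 < r -> {for r, continuous (rad_fun k n)}.
Proof.
move=> r0; have rn0 : r != 0 by rewrite gt_eqF.
apply: cvgM.
  apply: cvgM; first by apply: cvgV => //; exact: cvg_id.
  apply: cvgB; last exact: exprn_continuous.
  apply: cvgV; [by rewrite expf_neq0|exact: exprn_continuous].
have := is_derive_tail n _ r0 => -[dt _].
by have /derivable1_diffP/differentiable_continuous := dt.
Qed.

Lemma integral_rad_fun p k n : (0 < k)%N -> (2 * n.+1 = (2 * p + k).+1)%N ->
  (\int[mu]_(r in `]0%R, 1%R[) (rad_fun k n.+1 r)%:E =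
   ((2 ^+ (2 * n.+1) * (p`!%:R * (p + k)`!%:R / (2 * n.+1)`!%:R)
     - 2 * wallis n.+1) / k%:R)%:E)%E.
Proof.
move=> k0 e.
have kn : (k < 2 * n.+1)%N by rewrite e ltnS leq_addl.
have c : {within `[0, 1], continuous (rad_fun k n.+1)}.
  apply/continuous_within_itvP => //; split.
  - by move=> r; rewrite in_itv/= => /andP[r0 _]; exact: continuous_rad_fun.
  (* By the same convention [rad_fun] is 0 at the origin, which is its limit. *)
  - by rewrite [X in _ --> X](_ : _ = 0) ?/rad_fun ?invr0 ?mul0r//; exact: cvg_rad_fun.
  - by apply: cvg_at_left_filter; exact: continuous_rad_fun.
have m : measurable_fun (`]0, 1[ : set R) (rad_fun k n.+1).
  apply: open_continuous_measurable_fun => // r; rewrite inE/= in_itv/= => /andP[r0 _].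
  exact: continuous_rad_fun.
have dp (r : R) : 0 < r -> is_derive r 1 (rad_prim p k n.+1) (rad_fun k n.+1 r).
  by move=> r0; exact: is_derive_rad_prim.
have mE : measurable_fun (`]0, 1[ : set R) (EFin \o rad_fun k n.+1) by
  exact/measurable_EFinP.
transitivity (\int[mu]_(r in `[0%R, 1%R]) (rad_fun k n.+1 r)%:E)%E.
  rewrite -integral_itv_bndo_bndc; last by rewrite -emeasurable_fun_itv_obnd_cbndP.
  by rewrite integral_itv_obnd_cbnd.
rewrite (@continuous_FTC2 _ _ (rad_prim p k n.+1))//; last 2 first.
- split.
  + by move=> r; rewrite in_itv/= => /andP[r0 _]; case: (dp r r0).
  + exact: cvg_rad_prim.
  + apply: cvg_at_left_filter; have [d1 _] := dp 1 ltr01.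
    by have /derivable1_diffP/differentiable_continuous := d1.
- by move=> r; rewrite in_itv/= => /andP[r0 _]; rewrite derive1E; case: (dp r r0).
rewrite -EFinB; congr EFin.
(* At r = 1 both beta arguments are 1/2 and the terms cancel; at r = 0 the arguments are 0 and 1. *)
have -> : rad_prim p k n.+1 1 = - (2 * wallis n.+1) / k%:R.
  by rewrite /rad_prim tail1 !expr1n invr1 mul1r subrr mulr0 sub0r.
have -> : rad_prim p k n.+1 0 =
    - (2 ^+ (2 * n.+1) * (p`!%:R * (p + k)`!%:R / (2 * n.+1)`!%:R)) / k%:R.
  have k00 : (0 : R) ^+ k = 0 by rewrite expr0n gtn_eqF.
  rewrite /rad_prim k00 invr0 addr0 mul0r subr0 expr0n /= mul0r addr0 invr1.
  rewrite beta_prim0 beta_prim1 sub0r mulrN e.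
  by have -> : (p + (p + k) = 2 * p + k)%N by lia.
by rewrite -mulrBl; congr (_ / _); ring.
Qed.

(* Modulus part of the integrand of ip_beta for the exponents a, b with
   |a - b| = k and N = 2 n. *)
Definition radial (k n : nat) : R -> R :=
  (fun r => (Num.sqrt pi)^-1 * (r^-1 * rad_fun k n r)) \_ `]0, 1[.

Lemma rad0 k n (r : R) : r <= 0 -> radial k n r = 0.
Proof. by move=> r0; rewrite /radial patchE mem_setE in_itv/= ltNge r0. Qed.

Lemma rad_ge0 k n (r : R) : 0 <= radial k n r.
Proof.
rewrite /radial patchE mem_setE in_itv/=; case: ifP => // r01.
by case/andP: (r01) => r0 r1;
  rewrite mulr_ge0 ?invr_ge0 ?sqrtr_ge0// mulr_ge0 ?invr_ge0 ?(ltW r0) ?rad_fun_ge0.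
Qed.

Lemma measurable_rad k n : measurable_fun setT (radial k n).
Proof.
apply/(measurable_restrictT _ _).1 => //.
apply: open_continuous_measurable_fun => // r; rewrite inE/= in_itv/= => /andP[r0 _].
apply: cvgMr; apply: cvgM; last exact: continuous_rad_fun.
by apply: cvgV; [rewrite gt_eqF|exact: cvg_id].
Qed.

(** The Jacobian r of polar coordinates cancels the extra r^-1 in [radial]. *)
Lemma integral_radE k n : (\int[mu]_r (r * radial k n r)%:E =
  (Num.sqrt pi)^-1%:E * \int[mu]_(r in `]0%R, 1%R[) (rad_fun k n r)%:E)%E.
Proof.
rewrite -ge0_integralZl//; last 2 first.
- apply/measurable_EFinP; apply: open_continuous_measurable_fun => // r.
  by rewrite inE/= in_itv/= => /andP[r0 _]; exact: continuous_rad_fun.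
- by move=> r; rewrite /= in_itv/= lee_fin => r01; exact: rad_fun_ge0.
rewrite [RHS]integral_mkcond; apply: eq_integral => r _.
rewrite /radial !patchE mem_setE in_itv/=; case: ifP => [/andP[r0 _]|];
  last by rewrite mulr0.
rewrite -EFinM; congr EFin; field.
by rewrite !gt_eqF// sqrtr_gt0 pi_gt0.
Qed.

Lemma integral_rad p k n : (0 < k)%N -> (2 * n.+1 = (2 * p + k).+1)%N ->
  (\int[mu]_r (r * radial k n.+1 r)%:E =
   ((Num.sqrt pi)^-1 * ((2 ^+ (2 * n.+1) * (p`!%:R * (p + k)`!%:R / (2 * n.+1)`!%:R)
     - 2 * wallis n.+1) / k%:R))%:E)%E.
Proof. by move=> k0 e; rewrite integral_radE (integral_rad_fun p)// EFinM. Qed.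

(** The closed form needs k odd. An even k is dominated by l = k + 1, still below N because N is
    even. *)
Lemma integral_rad_fin k n : (k < 2 * n.+1)%N ->
  exists H : R, (\int[mu]_r (r * radial k n.+1 r)%:E = H%:E)%E.
Proof.
move=> kn.
pose l := (k./2.*2).+1; have kl : (k <= l)%N by rewrite /l; lia.
have ln : (l < 2 * n.+1)%N by rewrite /l; lia.
pose p := (n - k./2)%N; have e : (2 * n.+1 = (2 * p + l).+1)%N by rewrite /p /l; lia.
have : (0 <= \int[mu]_r (r * radial k n.+1 r)%:E <= \int[mu]_r (r * radial l n.+1
  r)%:E)%E.
  have h0 (m : nat) (r : R) : 0 <= r * radial m n.+1 r.
    have [r0|r0] := leP r 0; first by rewrite rad0// mulr0.
    by rewrite mulr_ge0 ?rad_ge0 ?(ltW r0).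
  have hm (m : nat) : measurable_fun setT (fun r : R => (r * radial m n.+1 r)%:E).
    by apply/measurable_EFinP; apply: measurable_funM => //; exact: measurable_rad.
  rewrite integral_ge0/=; last by move=> r _; rewrite lee_fin.
  apply: ge0_le_integral => //.
  - by move=> r _; rewrite lee_fin.
  - exact: hm.
  - exact: hm.
  move=> r _; rewrite lee_fin /radial !patchE mem_setE in_itv/=; case: ifP => // r01.
  case/andP: (r01) => r0 r1; rewrite !ler_wpM2l ?invr_ge0 ?sqrtr_ge0 ?(ltW r0)//.
  exact: rad_fun_le.
rewrite (integral_rad p l)//.
by case: (\int[mu]_r _)%E => [r _|/andP[_]|/andP[]]; [exists r|rewrite leye_eq|].
Qed.

End radial.

(** * Polar form of [tau] *)

Section tau.
Context {R : realType}.
Let mu := @lebesgue_measure R.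
Implicit Types (r t : R) (z : R[i]).

Lemma expiD t t' : expi (t + t') = expi t * expi t'.
Proof. by rewrite /expi cosD sinD; apply/eqP; rewrite eq_complex /= eqxx addrC eqxx. Qed.

Lemma expi0 : expi (0 : R) = 1.
Proof. by rewrite /expi cos0 sin0. Qed.

Lemma expiMn t n : expi (n%:R * t) = expi t ^+ n.
Proof.
elim: n => [|n IH]; first by rewrite mul0r expi0.
by rewrite -natr1 mulrDl mul1r expiD IH exprSr.
Qed.

Lemma conjc_expi t : conjc (expi t) = expi (- t).
Proof. by rewrite /expi cosN sinN. Qed.

Lemma expi_neq0 t : expi t != 0.
Proof.
apply/eqP => h; have := expiD t (- t); rewrite subrr expi0 h mul0r => /eqP.
by rewrite oner_eq0.
Qed.

(** Equal values force cos(t - t') = 1, so the sine vanishes at half the difference, which lies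
    strictly between -pi and pi. *)
Lemma expi_inj t t' : 0 <= t < 2 * pi -> 0 <= t' < 2 * pi -> expi t = expi t' -> t = t'.
Proof.
move=> /andP[t0 t1] /andP[t0' t1'] [ec es].
pose d := (t - t') / 2.
have c1 : cos (d *+ 2) = 1.
  have -> : d *+ 2 = t - t' by rewrite -mulr_natr /d; field.
  by rewrite cosB ec es -!expr2 cos2Dsin2.
have s0 : sin d = 0.
  apply/eqP; rewrite -sqrf_eq0 sin2cos2; move: c1; rewrite cos_mulr2n => h.
  by apply/eqP; lra.
have [d0|d0|d0] := ltgtP d 0; last by move: d0; rewrite /d; lra.
- have : 0 < sin (- d) by apply: sin_gt0_pi; rewrite /d in d0 *; lra.
  by rewrite sinN s0 oppr0 ltxx.
- have : 0 < sin d by apply: sin_gt0_pi; rewrite /d in d0 *; lra.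
  by rewrite s0 ltxx.
Qed.

Lemma modulus_polar r t : 0 <= r -> modulus (r%:C * expi t) = r.
Proof.
move=> r0; rewrite /modulus /= !mul0r subr0 addr0.
by rewrite !exprMn -mulrDr cos2Dsin2 mulr1 sqrtr_sqr ger0_norm.
Qed.

Lemma arg_polar r t : 0 < r -> 0 <= t < 2 * pi -> arg (r%:C * expi t) = t.
Proof.
move=> r0 t01; rewrite /arg; apply: xget_unique.
  by split=> //; rewrite modulus_polar ?(ltW r0).
move=> t' [t01']; rewrite modulus_polar ?(ltW r0)// => /mulfI h.
apply/esym/expi_inj => //; apply: h.
by apply/eqP => -[] /eqP; rewrite gt_eqF.
Qed.

Lemma modulus_gt0 z : z != 0 -> 0 < modulus z.
Proof.
case: z => a b; rewrite eq_complex /= negb_and => h.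
rewrite /modulus /= sqrtr_gt0 lt_neqAle addr_ge0 ?sqr_ge0// andbT eq_sym.
by rewrite paddr_eq0 ?sqr_ge0// !sqrf_eq0 negb_and.
Qed.

Lemma arg_spec z : z != 0 -> 0 <= arg z < 2 * pi /\ z = (modulus z)%:C * expi (arg z).
Proof.
move=> z0; apply: (@xgetPex _ 0 [set t | 0 <= t < 2 * pi /\ z = (modulus z)%:C * expi t]).
have := modulus_gt0 _ z0; case: z z0 => a b _.
set r := modulus _ => r0.
have r2 : r ^+ 2 = a ^+ 2 + b ^+ 2 by rewrite sqr_sqrtr// addr_ge0 ?sqr_ge0.
have ab1 : (a / r) ^+ 2 + (b / r) ^+ 2 = 1.
  by rewrite !expr_div_n -mulrDl -r2 divff// expf_neq0// gt_eqF.
have a1 : -1 <= a / r <= 1.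
  rewrite -ler_norml -(@ler_pXn2r _ 2) ?nnegrE// expr1n real_normK ?num_real//.
  by rewrite -ab1 lerDl sqr_ge0.
have ca : cos (acos (a / r)) = a / r by rewrite acosK.
have sa : sin (acos (a / r)) = `|b / r|.
  by rewrite sin_acos// -ab1 addrAC subrr add0r sqrtr_sqr.
have pi0 := pi_gt0 R.
have [c0 cpi] : 0 <= acos (a / r) /\ acos (a / r) <= pi by rewrite acos_ge0// acos_lepi.
have rr x : r * (x / r) = x by field; rewrite gt_eqF.
have [b0|b0] := leP 0 b.
  exists (acos (a / r)); split; first by apply/andP; split=> //; lra.
  rewrite /expi ca sa ger0_norm ?divr_ge0 ?(ltW r0)//.
  by apply/eqP; rewrite eq_complex /= !mul0r subr0 addr0 !rr !eqxx.
(* Lower half-plane: the angle stays below 2 pi because a zero arccosine would force b = 0. *)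
exists (2 * pi - acos (a / r)); split.
  have : 0 < acos (a / r).
    rewrite lt_neqAle c0 andbT; apply/eqP => h.
    move: sa; rewrite -h sin0 => /esym/eqP; rewrite normr_eq0 mulf_eq0 invr_eq0.
    by rewrite (gt_eqF r0) (lt_eqF b0).
  by lra.
rewrite /expi mulr_natl cosB sinB cos2pi sin2pi ca sa ltr0_norm ?pmulr_llt0 ?invr_gt0//.
rewrite !mul0r !mul1r addr0 sub0r opprK.
by apply/eqP; rewrite eq_complex /= !mul0r subr0 addr0 !rr !eqxx.
Qed.

(** The [s] of [tau] at N = 2 n, that is n - 1/2. *)
Definition half_exponent (n : nat) : R := ((2 * n)%:R - 1) / 2.

Lemma tau_polar n r t : 0 < r -> 0 <= t < 2 * pi ->
  tau (2 * n) (r%:C * expi t) = (r `^ (- half_exponent n))%:C * expi (- (half_exponent n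
    * t)) *
   (Num.sqrt ((Num.sqrt pi)^-1 * (wallis n - invD_prim n (`|r^-1 - r| / 2))))%:C.
Proof.
move=> r0 t01; rewrite /tau modulus_polar ?(ltW r0)// arg_polar// /half_exponent.
congr (_ * (Num.sqrt (_ * _))%:C).
rewrite -[RHS]/(fine (_%:E)) -integral_invD /Rintegral; congr fine.
apply: eq_integral => x _; congr EFin; rewrite /invD; congr _^-1.
have -> : (2 * n)%:R / 2 + 1 = n.+1%:R :> R by rewrite natrM -natr1; field.
by rewrite powR_mulrn// (ltW (oneDsqr_gt0 _)).
Qed.

Lemma tau_circle n t : 0 <= t < 2 * pi ->
  tau (2 * n) (expi t) = (Num.sqrt ((Num.sqrt pi)^-1 * wallis n))%:C * expi (-
    (half_exponent n * t)).
Proof.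
move=> t01; have := tau_polar n 1 t ltr01 t01.
rewrite mul1r => ->; rewrite powR1 mul1r invr1 subrr normr0 mul0r invD_prim0 subr0.
exact: mulrC.
Qed.

Lemma conjc_inv_polar r t : (conjc (r%:C * expi t))^-1 = (r^-1)%:C * expi t.
Proof.
have e0 := expi_neq0 (- t).
have -> : conjc (r%:C * expi t) = r%:C * expi (- t).
  by apply/eqP; rewrite eq_complex /= cosN sinN; apply/andP; split; apply/eqP; ring.
rewrite invfM.
congr (_ * _); first by rewrite fmorphV.
by apply: (mulfI e0); rewrite divff// -expiD addNr expi0.
Qed.

(** The points w and 1 / conj(w) have the same argument and reciprocal moduli: the powers of the
    moduli cancel, and the two square roots agree because |1/r - r| is invariant under r -> 1/r. *)
Lemma tau_reflect n r t : 0 < r < 1 -> 0 <= t < 2 * pi ->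
  tau (2 * n) (r%:C * expi t) * tau (2 * n) (conjc (r%:C * expi t))^-1 =
  ((Num.sqrt pi)^-1 * tail n r)%:C * expi (- ((2 * half_exponent n) * t)).
Proof.
move=> /andP[r0 r1] t01.
have rn0 : r != 0 by rewrite gt_eqF.
rewrite conjc_inv_polar.
have ri : 0 < r^-1 by rewrite invr_gt0.
rewrite !tau_polar// invrK.
have h : 0 <= r^-1 - r by rewrite subr_ge0 (@le_trans _ _ 1) ?(ltW r1)// invf_ge1 ?(ltW
  r1).
have dd : `|r - r^-1| = r^-1 - r by rewrite distrC ger0_norm.
rewrite dd (ger0_norm h) -/(tail n r).
set S := Num.sqrt _.
have S2 : S * S = (Num.sqrt pi)^-1 * tail n r.
  by rewrite -expr2 sqr_sqrtr// mulr_ge0 ?tail_ge0// invr_ge0 sqrtr_ge0.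
have P : r `^ (- half_exponent n) * (r^-1) `^ (- half_exponent n) = 1.
  by rewrite -powRM ?(ltW r0) ?(ltW ri)// divff// powR1.
have -> : - (2 * half_exponent n * t) = - (half_exponent n * t) + - (half_exponent n * t)
  by ring.
rewrite -S2 expiD rmorphM /=.
have := congr1 (@real_complex R) P; rewrite rmorphM rmorph1 /=.
move: (_%:C) (_%:C) (_%:C) (expi _) => A B C D AB.
rewrite -[RHS]mul1r -AB.
ring.
Qed.

End tau.

(** * The product over the circle *)

Section alpha.
Context {R : realType}.
Let mu := @lebesgue_measure R.
Implicit Types (t : R) (z : R[i]).

(** Common form of the real and imaginary parts of z exp(i v t), stable under differentiation. *)
Definition trig (x y v t : R) : R := x * cos (v * t) + y * sin (v * t).

Lemma is_derive_trig (x y v t : R) :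
  is_derive t 1 (trig x y v) (trig (y * v) (- x * v) v t).
Proof.
have h : is_derive t 1 (fun t : R => v * t) v.
  by apply: is_derive_eq; rewrite /GRing.scale /= mulr1.
have hc := is_derive1_comp (is_derive_cos (v * t)) h.
have hs := is_derive1_comp (is_derive_sin (v * t)) h.
have E : is_derive t 1 (fun t : R => x * (cos \o (fun t : R =>
  v * t)) t + y * (sin \o (fun t : R => v * t)) t)
   (trig (y * v) (- x * v) v t).
  by apply: is_derive_eq; rewrite /trig /GRing.scale /=; ring.
exact: E.
Qed.

Lemma continuous_trig (x y v : R) : continuous (trig x y v).
Proof.
move=> t; apply: differentiable_continuous; apply/derivable1_diffP.
by case: (is_derive_trig x y v t).
Qed.

Lemma Rintegral_trig (x y v a b : R) : v != 0 -> a <= b ->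
  \int[mu]_(t in `[a, b]) trig x y v t = trig (- y / v) (x / v) v b - trig (- y / v) (x /
    v) v a.
Proof.
move=> v0; rewrite le_eqVlt => /predU1P[->|ab].
  by rewrite set_itv1 Rintegral_set1 subrr.
rewrite /Rintegral (@continuous_FTC2 _ _ (trig (- y / v) (x / v) v))//.
- by apply: continuous_subspaceT; exact: continuous_trig.
- split.
  + by move=> t _; case: (is_derive_trig (- y / v) (x / v) v t).
  + by apply: cvg_at_right_filter; exact: continuous_trig.
  + by apply: cvg_at_left_filter; exact: continuous_trig.
- move=> t _; rewrite derive1E; case: (is_derive_trig (- y / v) (x / v) v t) => _ ->.
  have -> : x / v * v = x by field.
  by have -> : - (- y / v) * v = y by field.
Qed.

Lemma measurable_sgr : measurable_fun setT (@Num.sg R).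
Proof.
have -> : @Num.sg R = fun x : R => (0 < x)%R%:R - (x < 0)%R%:R :> R.
  apply/funext => x; case: (ltgtP x 0) => h.
  - by rewrite ltr0_sg// sub0r.
  - by rewrite gtr0_sg// subr0.
  - by rewrite h sgr0 subrr.
by apply: measurable_funB; apply: measurableT_comp => //; exact: measurable_fun_ltr.
Qed.

Lemma Rintegral_sgr (f : R -> R) (a b c : R) : a <= c <= b -> continuous f ->
  \int[mu]_(t in `[a, b]) (f t * Num.sg (t - c)) =
  \int[mu]_(t in `[c, b]) f t - \int[mu]_(t in `[a, c]) f t.
Proof.
move=> /andP[ac cb] cf.
have fi (x y : R) : mu.-integrable `[x, y] (EFin \o f).
  apply: continuous_compact_integrable; first exact: segment_compact.
  exact: continuous_subspaceT.
have gi : mu.-integrable `[a, b] (EFin \o (fun t => f t * Num.sg (t - c))).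
  apply: (le_integrable _ _ _ (fi a b)) => //.
    apply/measurable_EFinP; apply: measurable_funTS; apply: measurable_funM.
      exact: continuous_measurable_fun.
    apply: (measurableT_comp measurable_sgr); exact: measurable_funB.
  move=> t _ /=; rewrite lee_fin normrM normr_sg ler_piMr//.
  by case: (_ == _).
rewrite -[LHS](subrK (\int[mu]_(t in `[a, c]) (f t * Num.sg (t - c)))).
rewrite (Rintegral_itvB gi)//.
congr (_ + _).
  transitivity (\int[mu]_(t in `]c, b]) f t).
    apply: eq_Rintegral => t; rewrite inE/= in_itv/= => /andP[ct _].
    by rewrite gtr0_sg ?subr_gt0// mulr1.
  apply: Rintegral_itv_obnd_cbnd; apply: integrableS (fi c b) => //.
  exact: subset_itv_oc_cc.
have si : `[a, c] `<=` (`[a, b] : set R) by apply: subset_itvl; rewrite bnd_simp.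
rewrite -Rintegral_itv_bndo_bndc; last first.
  apply: integrableS gi => //; apply: (subset_trans _ si); exact: subset_itv_co_cc.
rewrite -[in RHS]Rintegral_itv_bndo_bndc; last first.
  apply: integrableS (fi a c) => //; exact: subset_itv_co_cc.
have fac : mu.-integrable `[a, c[ (EFin \o f).
  apply: integrableS (fi a c) => //; exact: subset_itv_co_cc.
have := @RintegralZl _ _ R mu `[a, c[%classic f (-1) (measurable_itv _) fac.
rewrite mulN1r => <-.
apply: eq_Rintegral => t; rewrite inE/= in_itv/= => /andP[_ ct].
by rewrite ltr0_sg ?subr_lt0// mulrC.
Qed.

(** [arg] returns 0 rather than 2 pi, so the exponential formula for [tau] on the circle fails at t
    = 2 pi. Agreement away from b suffices, and measurability is asked of G only. *)
Lemma Cintegral_eq_co (F G : R -> R[i]) (a b : R) :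
  (forall t, a <= t < b -> F t = G t) ->
  measurable_fun setT (fun t => complex.Re (G t)) ->
  measurable_fun setT (fun t => complex.Im (G t)) ->
  Cintegral mu `[a, b] F = Cintegral mu `[a, b] G.
Proof.
move=> FG mR mI; rewrite /Cintegral /Rintegral.
have H (p q : R -> R) : measurable_fun setT q -> (forall t, a <= t < b -> p t = q t) ->
  (\int[mu]_(x in `[a, b]) (p x)%:E = \int[mu]_(x in `[a, b]) (q x)%:E)%E.
  move=> mq pq.
  rewrite -integral_itv_bndo_bndc; last first.
    apply/measurable_EFinP; apply: (eq_measurable_fun q).
      by move=> t; rewrite inE/= in_itv/= => h; rewrite pq.
    exact: measurable_funTS.
  rewrite -[RHS]integral_itv_bndo_bndc; last first.
    by apply/measurable_EFinP; exact: measurable_funTS.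
  by apply: eq_integral => t; rewrite inE/= in_itv/= => h; rewrite pq.
by congr (_ +i* _); congr fine; apply: H => // t h; rewrite FG.
Qed.

Lemma ReM_expi z (v t : R) : complex.Re (z * expi (v * t)) = trig (complex.Re z) (-
  complex.Im z) v t.
Proof. by case: z => a b /=; rewrite /trig mulNr. Qed.

Lemma ImM_expi z (v t : R) : complex.Im (z * expi (v * t)) = trig (complex.Im z)
  (complex.Re z) v t.
Proof. by case: z => a b /=; rewrite /trig addrC. Qed.

(** The factor [0 -i* v^-1] is 1 / (i v). *)
Lemma Cintegral_expi z (v a b : R) : v != 0 -> a <= b ->
  Cintegral mu `[a, b] (fun t => z * expi (v * t)) =
  z * (0 -i* v^-1) * (expi (v * b) - expi (v * a)).
Proof.
move=> v0 ab; rewrite /Cintegral.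
under eq_Rintegral do rewrite ReM_expi.
under [X in _ +i* X]eq_Rintegral do rewrite ImM_expi.
rewrite !Rintegral_trig//; case: z => x y /=.
apply/eqP; rewrite eq_complex /= /trig; apply/andP; split; apply/eqP; field; exact: v0.
Qed.

Lemma Cintegral_expi_sgr z (v a b c : R) : v != 0 -> a <= c <= b ->
  Cintegral mu `[a, b] (fun t => z * expi (v * t) * (Num.sg (t - c))%:C) =
  z * (0 -i* v^-1) * (expi (v * b) + expi (v * a) - 2 * expi (v * c)).
Proof.
move=> v0 acb; case/andP: (acb) => ac cb.
have Re_r (w : R[i]) (r : R) : complex.Re (w * r%:C) = complex.Re w * r.
  by case: w => p q /=; rewrite mulr0 subr0.
have Im_r (w : R[i]) (r : R) : complex.Im (w * r%:C) = complex.Im w * r.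
  by case: w => p q /=; rewrite mulr0 add0r.
rewrite /Cintegral.
under eq_Rintegral do rewrite Re_r ReM_expi.
under [X in _ +i* X]eq_Rintegral do rewrite Im_r ImM_expi.
rewrite !Rintegral_sgr//; try exact: continuous_trig.
rewrite !Rintegral_trig//; case: z => x y /=.
apply/eqP; rewrite eq_complex /= /trig; apply/andP; split; apply/eqP; field; exact: v0.
Qed.

Lemma expi_2pi n : expi (n%:R * (2 * pi) : R) = 1.
Proof.
by rewrite expiMn /expi mulr_natl cos2pi sin2pi; exact: expr1n.
Qed.

(** The frequency is a half-integer, so the exponential changes sign over one period. In the inner
    integral of [ip_alpha] the two boundary terms then cancel, and only the jump of the sign
    function contributes. *)
Lemma expi_2pi_half n b : expi ((b%:R - half_exponent n) * (2 * pi) : R) = - 1.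
Proof.
have := expi_2pi n; have := expi_2pi b => hb hn.
have h : b%:R * (2 * pi) + pi = (b%:R - half_exponent n) * (2 * pi) + n%:R * (2 * pi) :>
  R.
  by rewrite /half_exponent natrM; field.
have := congr1 (@expi R) h; rewrite expiD hb mul1r (expiD _ (n%:R * _)) hn mulr1 => <-.
by rewrite /expi cospi sinpi; apply/eqP; rewrite eq_complex /= oppr0 !eqxx.
Qed.

Lemma Cintegral_period (z : R[i]) (m : R) : expi (m * (2 * pi)) = 1 ->
  Cintegral mu `[0, 2 * pi] (fun t => z * expi (m * t)) =
  if m == 0 then z * (2 * pi)%:C else 0.
Proof.
have p0 : 0 <= 2 * pi :> R by rewrite mulr_ge0 ?pi_ge0.
case: eqP => [-> _|/eqP m0 e]; last first.
  by rewrite Cintegral_expi// mulr0 expi0 e subrr mulr0.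
rewrite /Cintegral.
under eq_Rintegral do rewrite mul0r expi0 mulr1.
under [X in _ +i* X]eq_Rintegral do rewrite mul0r expi0 mulr1.
rewrite !Rintegral_cst//= lebesgue_measure_itv/= lte_fin.
have -> : 0 < 2 * pi :> R by rewrite mulr_gt0 ?pi_gt0.
case: z => x y; rewrite -EFinB/= subr0.
by apply/eqP; rewrite eq_complex /= !mulr0 subr0 add0r !eqxx.
Qed.

Lemma half_neq0 n b : b%:R - half_exponent n != 0 :> R.
Proof.
apply/eqP => h; have : (2 * b + 1)%:R = (2 * n)%:R :> R.
  by move: h; rewrite /half_exponent natrD !natrM => h; lra.
by move/eqP; rewrite eqr_nat => /eqP; lia.
Qed.

(** The inner integral is 2 i / v times a single exponential, with v = b - (N-1)/2. The outer one is
    then that of exp(i (a + b - N + 1) t) over a period, and -(i/2) (2 i / v) 2 pi = 2 pi / v. *)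
Lemma ip_alphaXX n a b :
  ip_alpha (2 * n) ('X^a : {poly R[i]}) 'X^b =
  if ((a + b).+1 == 2 * n)%N then
    (2 * pi / (b%:R - half_exponent n) * ((Num.sqrt pi)^-1 * wallis n))%:C else 0.
Proof.
set K := (Num.sqrt pi)^-1 * wallis n.
have K0 : 0 <= K.
  by rewrite mulr_ge0 ?invr_ge0 ?sqrtr_ge0// -tail1 tail_ge0.
have KK : (Num.sqrt K)%:C * (Num.sqrt K)%:C = K%:C :> R[i].
  by rewrite -rmorphM /= -expr2 sqr_sqrtr.
pose v : R := b%:R - half_exponent n; pose u : R := a%:R - half_exponent n.
have v0 : v != 0 by exact: half_neq0.
have p0 : 0 <= 2 * pi :> R by rewrite mulr_ge0 ?pi_ge0.
have ev : expi (v * (2 * pi)) = - 1 by exact: expi_2pi_half.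
have eu : expi (u * (2 * pi)) = - 1 by exact: expi_2pi_half.
have tE (t : R) (c : nat) : 0 <= t < 2 * pi ->
    tau (2 * n) (expi t) * expi t ^+ c = (Num.sqrt K)%:C * expi ((c%:R - half_exponent n)
      * t).
  move=> t01; rewrite tau_circle// -/K -expiMn -mulrA -expiD; congr (_ * expi _); ring.
have inner (t : R) : 0 <= t < 2 * pi ->
  Cintegral mu `[0, 2 * pi] (fun t2 =>
    tau (2 * n) (expi t2) * ('X^a : {poly R[i]}).[expi t] *
     ('X^b : {poly R[i]}).[expi t2] * (Num.sg (t2 - t))%:C) =
  (Num.sqrt K)%:C * expi t ^+ a * (0 +i* (2 / v)) * expi (v * t).
  move=> t01.
  rewrite (Cintegral_eq_co _ (fun t2 =>
    (Num.sqrt K)%:C * expi t ^+ a * expi (v * t2) * (Num.sg (t2 - t))%:C)).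
  - rewrite Cintegral_expi_sgr//; last by case/andP: t01 => -> /ltW ->.
    rewrite ev mulr0 expi0 addNr sub0r -!mulrA; congr (_ * (_ * _)).
    rewrite mulrN -mulNr mulrA; congr (_ * _).
    by apply/eqP; rewrite eq_complex /= ; apply/andP; split; apply/eqP; ring.
  - move=> t2 t2b; rewrite !hornerXn.
    rewrite [_ * _ ^+ a * _]mulrAC tE// -/v; congr (_ * _); exact: mulrAC.
  - under eq_fun => t2.
      have -> : complex.Re ((Num.sqrt K)%:C * expi t ^+ a * expi (v * t2) * (Num.sg (t2 -
        t))%:C)
         = complex.Re ((Num.sqrt K)%:C * expi t ^+ a * expi (v * t2)) * Num.sg (t2 - t).
        by case: (_ * expi (v * t2)) => p q /=; rewrite mulr0 subr0.
      rewrite ReM_expi; over.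
    apply: measurable_funM; first by apply: continuous_measurable_fun;
      exact: continuous_trig.
    by apply: (measurableT_comp measurable_sgr); exact: measurable_funB.
  - under eq_fun => t2.
      have -> : complex.Im ((Num.sqrt K)%:C * expi t ^+ a * expi (v * t2) * (Num.sg (t2 -
        t))%:C)
         = complex.Im ((Num.sqrt K)%:C * expi t ^+ a * expi (v * t2)) * Num.sg (t2 - t).
        by case: (_ * expi (v * t2)) => p q /=; rewrite mulr0 add0r.
      rewrite ImM_expi; over.
    apply: measurable_funM; first by apply: continuous_measurable_fun;
      exact: continuous_trig.
    by apply: (measurableT_comp measurable_sgr); exact: measurable_funB.
rewrite /ip_alpha.
rewrite (Cintegral_eq_co _ (fun t => K%:C * (0 +i* (2 / v)) * expi ((u + v) * t))).
- rewrite Cintegral_period; last by rewrite mulrDl expiD eu ev mulrNN mulr1.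
  have -> : (u + v == 0) = ((a + b).+1 == 2 * n)%N.
    have -> : u + v = (a + b).+1%:R - (2 * n)%:R.
      by rewrite /u /v /half_exponent -[(a + b).+1%:R]natr1 [(a + b)%N%:R]natrD ![(2 *
        n)%N%:R]natrM; field.
    by rewrite subr_eq0 eqr_nat.
  case: ifP => _; last by rewrite mulr0.
  have -> : 2 * pi / v * K = K * (2 / v) * pi by field.
  have -> : ('i / 2 : R[i]) = 0 +i* 2^-1.
    apply: (mulIf (_ : 2 != 0 :> R[i])); first by rewrite pnatr_eq0.
    rewrite divfK ?pnatr_eq0//.
    by apply/eqP; rewrite eq_complex /=; apply/andP; split; apply/eqP; field.
  by apply/eqP; rewrite eq_complex /=; apply/andP; split; apply/eqP; field.
- move=> t t01; rewrite inner//; have := tE t a t01; rewrite -/u.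
  move: (tau _ _) => T h.
  transitivity (T * expi t ^+ a * ((Num.sqrt K)%:C * (0 +i* (2 / v)) * expi (v * t))).
    by move: (expi t ^+ a) (expi (v * t)) (Num.sqrt K)%:C => x1 x2 x3; ring.
  rewrite h [(u + v) * t]mulrDl [expi (u * t + v * t)]expiD -KK.
  by move: (expi (u * t)) (expi (v * t)) (Num.sqrt K)%:C => x1 x2 x3; ring.
- under eq_fun do rewrite ReM_expi.
  by apply: continuous_measurable_fun; exact: continuous_trig.
- under eq_fun do rewrite ImM_expi.
  by apply: continuous_measurable_fun; exact: continuous_trig.
Qed.

End alpha.

(** * The product over the disk *)

Section planar.
Context {R : realType}.
Let mu := @lebesgue_measure R.

Definition rho (z : R * R) : R := Num.sqrt (z.1 ^+ 2 + z.2 ^+ 2).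

Lemma measurable_rho : measurable_fun setT rho.
Proof.
apply: measurableT_comp; first exact: continuous_measurable_fun (@sqrt_continuous R).
by apply: measurable_funD; exact: measurable_funX.
Qed.

(** This is the full angle: summing the constant 1 over four reflections gives the weight 4 on
    slopes u > 0. *)
Lemma integral_4 : (\int[mu]_u ((0 < u)%R%:R * 4 / (1 + u ^+ 2))%:E = (2 * pi)%:E)%E.
Proof.
transitivity (\int[mu]_(u in `[0%R, +oo[) (4 * invD 0 u)%:E)%E.
  rewrite -integral_itv_obnd_cbnd; last first.
    apply/measurable_EFinP; apply: measurable_funTS; apply: measurable_funM => //.
    exact: continuous_measurable_fun (@continuous_invD R 0).
  rewrite [RHS]integral_mkcond; apply: eq_integral => u _.
  rewrite patchE mem_setE in_itv/= andbT /invD expr1; case: ifP => _;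
    by rewrite ?mul1r// !mul0r.
under eq_integral do rewrite EFinM.
rewrite ge0_integralZl//; last 2 first.
- by apply/measurable_EFinP; apply: measurable_funTS;
  exact: continuous_measurable_fun (@continuous_invD R 0).
- by move=> u _; rewrite lee_fin; exact/ltW/invD_gt0.
by rewrite integral_invD invD_prim0 -EFinM subr0 /=; congr EFin; field.
Qed.

(** The polar formula is for nonnegative functions, whereas c may change sign. As |c| <= 1, it
    applies to h and to (1 + c) h, with slope weights 4 and 4 + C; the difference of the two
    integrals is S * H. *)
Lemma Rintegral_planar (c : R * R -> R) (h C : R -> R) (S H : R) :
  measurable_fun setT c -> (forall z, `|c z| <= 1) ->
  measurable_fun setT C -> (forall u, `|C u| <= 4) ->
  measurable_fun setT h -> (forall r, 0 <= h r) -> (forall r : R, r <= 0 -> h r = 0) ->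
  (forall x y : R, 0 < x -> 0 < y ->
    c (x, y) + c (- x, y) + (c (x, - y) + c (- x, - y)) = C (y / x)) ->
  (\int[mu]_r (r * h r)%:E = H%:E)%E ->
  (\int[mu]_u ((0 < u)%R%:R * (4 + C u) / (1 + u ^+ 2))%:E = (2 * pi + S)%:E)%E ->
  (mu \x mu)%E.-integrable setT (EFin \o (fun z => c z * h (rho z))) /\
  \int[(mu \x mu)%E]_z (c z * h (rho z)) = S * H.
Proof.
move=> mc c1 mC C4 mh h0 hneg fold IH IS.
have mI : measurable_fun setT (fun u : R => (0 < u)%R%:R : R).
  by apply: measurableT_comp => //; exact: measurable_fun_ltr.
have mhr : measurable_fun setT (fun z =>
  h (rho z)) by exact: (measurableT_comp mh measurable_rho).
have rN (x y : R) : rho (- x, y) = rho (x, y) by rewrite /rho /= sqrrN.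
have rN2 (x y : R) : rho (x, - y) = rho (x, y) by rewrite /rho /= sqrrN.
have I0 : (\int[mu \x mu]_z (h (rho z))%:E = (2 * pi * H)%:E)%E.
  rewrite (@ge0_integral_polar _ _ (fun u => (0 < u)%R%:R * 4) h)//.
  - by rewrite integral_4 IH -EFinM.
  - exact: measurable_funM.
  - by move=> u u0; rewrite ltNge u0 mul0r.
  - move=> x y x0 y0; rewrite !rN !rN2 ?rN divr_gt0// mul1r -/(rho (x, y)).
    by rewrite /rho /=; ring.
have cg (z : R * R) : 0 <= 1 + c z by have := c1 z; rewrite ler_norml => /andP[? _]; lra.
have Cg (u : R) : 0 <= 4 + C u by have := C4 u; rewrite ler_norml => /andP[? _]; lra.
have I1 : (\int[mu \x mu]_z ((1 + c z) * h (rho z))%:E = ((2 * pi + S) * H)%:E)%E.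
  rewrite (@ge0_integral_polar _ _ (fun u => (0 < u)%R%:R * (4 + C u)) h)//.
  - by rewrite IS IH -EFinM.
  - by apply: measurable_funM => //; exact: measurable_funD.
  - by move=> z; rewrite mulr_ge0.
  - by apply: measurable_funM => //; exact: measurable_funD.
  - by move=> u; rewrite mulr_ge0.
  - by move=> u u0; rewrite ltNge u0 mul0r.
  - move=> x y x0 y0; rewrite !rN !rN2 ?rN divr_gt0// mul1r -(fold _ _ x0 y0).
    by rewrite -/(rho (x, y)) /rho /=; ring.
have i0 : (mu \x mu)%E.-integrable setT (EFin \o (fun z => h (rho z))).
  apply/integrableP; split; first exact/measurable_EFinP.
  under eq_integral do rewrite /= ger0_norm//.
  by rewrite I0 ltry.
have i1 : (mu \x mu)%E.-integrable setT (EFin \o (fun z => (1 + c z) * h (rho z))).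
  apply/integrableP; split.
    by apply/measurable_EFinP; apply: measurable_funM => //; exact: measurable_funD.
  under eq_integral do rewrite /= ger0_norm ?mulr_ge0//.
  by rewrite I1 ltry.
have E : (fun z => c z * h (rho z)) = (fun z => (1 + c z) * h (rho z) - h (rho z)).
  by apply/funext => z; ring.
split.
  rewrite E; have := integrableB measurableT i1 i0; apply: eq_integrable => //.
rewrite E RintegralB// /Rintegral I0 I1 /=; ring.
Qed.

Section angular.
Variables A M : nat.

(** This is exp(i arg) written without [arg], which makes measurability and reflections easy to
    handle. At the origin it is 0, so its modulus is only bounded by 1. *)
Definition dir (z : R * R) : R[i] := (z.1 / rho z) +i* (z.2 / rho z).

(* With A = a + b and M = N - 1, the angular part of the integrand of ip_beta. *)
Definition ang (z : R * R) : R[i] := dir z ^+ A * conjc (dir z) ^+ M.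

Definition nsq (w : R[i]) : R := complex.Re w ^+ 2 + complex.Im w ^+ 2.

Lemma nsqM v w : nsq (v * w) = nsq v * nsq w.
Proof. by case: v w => a b [c d]; rewrite /nsq /=; ring. Qed.

Lemma nsqX w k : nsq (w ^+ k) = nsq w ^+ k.
Proof.
elim: k => [|k IH]; first by rewrite !expr0 /nsq /= expr0n addr0 expr1n.
by rewrite !exprS nsqM IH.
Qed.

Lemma nsq_dir z : nsq (dir z) <= 1.
Proof.
rewrite /nsq /= !expr_div_n -mulrDl.
have s0 : 0 <= z.1 ^+ 2 + z.2 ^+ 2 by rewrite addr_ge0 ?sqr_ge0.
rewrite /rho sqr_sqrtr//.
have [->|n0] := eqVneq (z.1 ^+ 2 + z.2 ^+ 2) 0; first by rewrite mul0r.
by rewrite divff.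
Qed.

Lemma nsq_ang z : nsq (ang z) <= 1.
Proof.
rewrite /ang nsqM !nsqX.
have -> : nsq (conjc (dir z)) = nsq (dir z) by rewrite /nsq /= sqrrN.
have n0 : 0 <= nsq (dir z) by rewrite /nsq addr_ge0 ?sqr_ge0.
by rewrite -exprD exprn_ile1 ?nsq_dir.
Qed.

Lemma Re_ang_le1 z : `|complex.Re (ang z)| <= 1.
Proof.
rewrite -(@ler_pXn2r _ 2) ?nnegrE// expr1n real_normK ?num_real//.
by apply: le_trans (nsq_ang z); rewrite /nsq lerDl sqr_ge0.
Qed.

Lemma Im_ang_le1 z : `|complex.Im (ang z)| <= 1.
Proof.
rewrite -(@ler_pXn2r _ 2) ?nnegrE// expr1n real_normK ?num_real//.
by apply: le_trans (nsq_ang z); rewrite /nsq lerDr sqr_ge0.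
Qed.

Definition cmeasurable (f : R * R -> R[i]) :=
  measurable_fun setT (fun z => complex.Re (f z)) /\
  measurable_fun setT (fun z => complex.Im (f z)).

Lemma cmeasurableM f g : cmeasurable f -> cmeasurable g -> cmeasurable (fun z =>
  f z * g z).
Proof.
move=> [f1 f2] [g1 g2]; split.
  rewrite (_ : (fun z => _) = (fun z =>
    complex.Re (f z) * complex.Re (g z) - complex.Im (f z) * complex.Im (g z))).
    by apply: measurable_funB; exact: measurable_funM.
  by apply/funext => z; case: (f z) (g z) => a b [].
rewrite (_ : (fun z => _) = (fun z =>
  complex.Re (f z) * complex.Im (g z) + complex.Im (f z) * complex.Re (g z))).
  by apply: measurable_funD; exact: measurable_funM.
by apply/funext => z; case: (f z) (g z) => a b [].
Qed.

Lemma cmeasurableX f k : cmeasurable f -> cmeasurable (fun z => f z ^+ k).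
Proof.
move=> mf; elim: k => [|k IH]; first by split; exact: measurable_cst.
under eq_fun do rewrite exprS.
exact: cmeasurableM.
Qed.

Lemma cmeasurable_ang : cmeasurable ang.
Proof.
have mr : measurable_fun setT (fun z => (rho z)^-1).
  rewrite (_ : (fun z => _) = (fun z => rho z `^ (-1))).
    exact: (measurableT_comp (measurable_powR (-1)) measurable_rho).
  by apply/funext => z; rewrite powR_inv1 ?sqrtr_ge0.
have m1 : measurable_fun setT (fun z : R * R => z.1 / rho z) by exact: measurable_funM.
have m2 : measurable_fun setT (fun z : R * R => z.2 / rho z) by exact: measurable_funM.
apply: cmeasurableM; apply: cmeasurableX; split => //=.
exact: measurableT_comp.
Qed.

(** With th = atan(y / x) the four directions are exp(i th), - exp(-i th), exp(-i th) and - exp(i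
    th). The sum is real, so the imaginary part of [ang] has slope weight 0. *)
Lemma ang_fold (x y : R) : 0 < x -> 0 < y ->
  ang (x, y) + ang (- x, y) + (ang (x, - y) + ang (- x, - y)) =
  ((1 + (-1) ^+ (A + M)) * (2 * cos ((A%:R - M%:R) * atan (y / x))))%:C.
Proof.
move=> x0 y0.
have r0 : 0 < x ^+ 2 + y ^+ 2 by rewrite addr_gt0 ?exprn_gt0.
have rE : rho (x, y) = x * Num.sqrt (1 + (y / x) ^+ 2).
  rewrite /rho /=; have -> : x ^+ 2 + y ^+ 2 = x ^+ 2 * (1 + (y / x) ^+ 2) by field;
    rewrite gt_eqF.
  by rewrite sqrtrM ?sqr_ge0// sqrtr_sqr gtr0_norm.
pose th := atan (y / x).
have s0 : 0 < Num.sqrt (1 + (y / x) ^+ 2) by rewrite sqrtr_gt0 oneDsqr_gt0.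
have dE : dir (x, y) = expi th.
  rewrite /dir rE /expi /=.
  have cE : cos th = (Num.sqrt (1 + (y / x) ^+ 2))^-1 by rewrite cos_atan.
  have sE : sin th = y / x / Num.sqrt (1 + (y / x) ^+ 2).
    have := atanK (y / x); rewrite -/th /tan => /esym h.
    rewrite [in LHS](_ : sin th = sin th / cos th * cos th); last first.
      by rewrite divfK// cE invr_eq0 gt_eqF.
    by rewrite -h cE.
  by rewrite cE sE; congr (_ +i* _); field; rewrite !gt_eqF.
have d2 : dir (x, - y) = expi (- th).
  by rewrite -conjc_expi -dE /dir /rho /= sqrrN mulNr.
have d3 : dir (- x, y) = - expi (- th).
  by rewrite -conjc_expi -dE /dir /rho /= sqrrN mulNr; apply/eqP;
    rewrite eq_complex /= opprK !eqxx.
have d4 : dir (- x, - y) = - expi th.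
  by rewrite -dE /dir /rho /= !sqrrN !mulNr; apply/eqP; rewrite eq_complex /= !eqxx.
have conjN (w : R[i]) : conjc (- w) = - conjc w.
  by case: w => a b; apply/eqP; rewrite eq_complex /= !eqxx.
have key (u v : R[i]) : (- u) ^+ A * (- v) ^+ M = (-1) ^+ (A + M) * (u ^+ A * v ^+ M).
  by rewrite -[- u]mulN1r -[- v]mulN1r !exprMn exprD mulrACA.
pose m : R := A%:R - M%:R.
have eP : expi th ^+ A * expi (- th) ^+ M = expi (m * th).
  by rewrite -!expiMn -expiD; congr expi; rewrite /m; ring.
have eQ : expi (- th) ^+ A * expi th ^+ M = expi (- (m * th)).
  by rewrite -!expiMn -expiD; congr expi; rewrite /m; ring.
rewrite /ang dE d2 d3 d4 !conjN !conjc_expi opprK !key eP eQ -/th -/m.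
have -> : (-1 : R[i]) ^+ (A + M) = ((-1) ^+ (A + M))%:C by rewrite rmorphXn /= rmorphN1.
move: ((-1) ^+ (A + M) : R) => s.
rewrite /expi cosN sinN.
by apply/eqP; rewrite eq_complex /=; apply/andP; split; apply/eqP; ring.
Qed.

(* Sum of ang over the four reflections of a point of slope u > 0. *)
Definition ang_weight (u : R) : R :=
  (1 + (-1) ^+ (A + M)) * (2 * cos ((A%:R - M%:R) * atan u)).

Lemma measurable_ang_weight : measurable_fun setT ang_weight.
Proof.
apply: measurable_funM => //; apply: measurable_funM => //.
apply: (@measurableT_comp _ _ _ _ _ _ (@cos R)).
  exact: continuous_measurable_fun (@continuous_cos R).
apply: measurable_funM => //; apply: continuous_measurable_fun => x;
  exact: continuous_atan.
Qed.

Lemma ang_weight_le4 u : `|ang_weight u| <= 4.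
Proof.
rewrite /ang_weight !normrM (ger0_norm (ler0n _ 2)).
have h1 : `|1 + (-1) ^+ (A + M)| <= 2 :> R.
  by apply: (le_trans (ler_normD _ _)); rewrite normrX normrN1 expr1n normr1.
have := cos_max ((A%:R - M%:R) * atan u).
move: (`|cos _|) (normr_ge0 (cos ((A%:R - M%:R) * atan u))) => c c0 c1.
move: h1 (normr_ge0 (1 + (-1) ^+ (A + M) : R)); move: `|_| => d d1 d0.
nra.
Qed.

(** Let m = A - M. For odd m opposite points cancel and the weight is 0. For even m, in the variable
    th = atan u, the integrand is 4 + 4 cos(m th) on ]0, pi/2[; if m is nonzero, m pi / 2 is a
    multiple of pi and the sine in the antiderivative vanishes, while m = 0 doubles the constant. *)
Lemma integral_ang_weight :
  (\int[mu]_u ((0 < u)%R%:R * (4 + ang_weight u) / (1 + u ^+ 2))%:E =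
   (2 * pi + (if A == M then 2 * pi else 0))%:E)%E.
Proof.
have [oAM|eAM] := boolP (odd (A + M)).
  have -> : (A == M) = false by apply/eqP => AM; move: oAM; rewrite AM addnn odd_double.
  rewrite addr0 -integral_4; apply: eq_integral => u _.
  by rewrite /ang_weight -signr_odd oAM expr1 subrr mul0r addr0.
have wE u : ang_weight u = 4 * cos ((A%:R - M%:R) * atan u).
  by rewrite /ang_weight -signr_odd (negbTE eAM) expr0; ring.
pose m : R := A%:R - M%:R.
pose f u := 4 * (1 + cos (m * atan u)) * invD 0 u.
have f0 u : 0 <= f u.
  rewrite mulr_ge0 ?(ltW (invD_gt0 _ _))// mulr_ge0//.
have cf : continuous f.
  move=> u; apply: cvgM; last exact: continuous_invD.
  apply: cvgMr; apply: cvgD; first exact: cvg_cst.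
  apply: (@continuous_comp _ _ _ (fun u => m * atan u) cos); last exact: continuous_cos.
  by apply: cvgMr; exact: continuous_atan.
transitivity (\int[mu]_(u in `[0%R, +oo[) (f u)%:E)%E.
  rewrite -integral_itv_obnd_cbnd; last first.
    by apply/measurable_EFinP; apply: measurable_funTS; exact: continuous_measurable_fun.
  rewrite [RHS]integral_mkcond; apply: eq_integral => u _.
  rewrite patchE mem_setE in_itv/= andbT; case: ifP => _; last by rewrite !mul0r.
  by rewrite mul1r wE /f /invD expr1 -/m; congr EFin; ring.
have dm (u : R) : is_derive u 1 (fun u : R => m * atan u) (m * invD 0 u).
  by rewrite /invD expr1; apply: is_derive_eq; rewrite /GRing.scale /=; ring.
have [AM|AM] := eqVneq A M.
  have m0 : m = 0 by rewrite /m AM subrr.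
  have d (u : R) : is_derive u 1 (fun u : R => 8 * atan u) (f u).
    apply: is_derive_eq; rewrite /f m0 mul0r cos0 /invD expr1 /GRing.scale /=; ring.
  rewrite (ge0_FTC2y _ (fun u => 8 * atan u) 0 (8 * (pi / 2)) (fun x _ => f0 x) cf d).
    by rewrite atan0 mulr0 subr0; congr EFin; field.
  by apply: cvgMr; exact: cvgy_atan.
have m0 : m != 0 by rewrite subr_eq0 eqr_nat.
have d (u : R) : is_derive u 1 (fun u : R => 4 * atan u + 4 / m * (sin \o (fun u =>
  m * atan u)) u) (f u).
  have hs := @is_derive1_comp R sin (fun u =>
    m * atan u) u _ _ (is_derive_sin (m * atan u)) (dm u).
  apply: is_derive_eq; rewrite /f /invD expr1 /GRing.scale /=; field.
  by rewrite m0 gt_eqF// oneDsqr_gt0.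
have sm : sin (m * (pi / 2)) = 0.
  have ez c : sin (c%:R * pi) = 0 :> R.
    elim: c => [|c IH]; first by rewrite mul0r sin0.
    by rewrite -natr1 mulrDl mul1r sinDpi IH oppr0.
  have [AM2|AM2] := leqP A M.
    have -> : m * (pi / 2) = - (((M - A)./2)%:R * pi).
      have h : (M = A + (M - A)./2 + (M - A)./2)%N by lia.
      by rewrite /m {1}h !natrD; field.
    by rewrite sinN ez oppr0.
  have -> : m * (pi / 2) = ((A - M)./2)%:R * pi.
    have h : (A = M + (A - M)./2 + (A - M)./2)%N by lia.
    by rewrite /m {1}h !natrD; field.
  exact: ez.
rewrite (ge0_FTC2y _ _ 0 (4 * (pi / 2) + 4 / m * 0) (fun x _ => f0 x) cf d).
  by rewrite /= atan0 !mulr0 sin0 mulr0 !addr0 subr0; congr EFin; field.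
apply: cvgD; apply: cvgMr; first exact: cvgy_atan.
rewrite -sm; apply: (@cvg_comp _ _ _ (fun u => m * atan u) sin _ (nbhs (m * (pi / 2))));
  last exact: continuous_sin.
by apply: cvgMr; exact: cvgy_atan.
Qed.

End angular.

(** Truncated subtraction makes [(a - b) + (b - a)] the distance |a - b|; the sign records which
    exponent is larger. *)
Lemma expr_diff (r : R) a b : r != 0 ->
  r ^+ a * r^-1 ^+ b - r ^+ b * r^-1 ^+ a =
  (-1) ^+ (b < a)%N * (r ^- ((a - b) + (b - a)) - r ^+ ((a - b) + (b - a))).
Proof.
move=> r0; have c1 c : r ^+ c * r^-1 ^+ c = 1 by rewrite -exprMn divff// expr1n.
have [ab|ba] := leqP a b.
  rewrite expr0 mul1r (eqP ab : (a - b = 0)%N) add0n -{1 2}(subnKC ab) !exprD.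
  rewrite mulrA c1 mul1r mulrAC c1 mul1r exprVn //.
rewrite expr1 (eqP (ltnW ba) : (b - a = 0)%N) addn0 -{1 2}(subnKC (ltnW ba)) !exprD.
rewrite mulrAC c1 mul1r mulrA c1 mul1r exprVn mulN1r opprB //.
Qed.

(** H is a parameter so that one statement serves both cases: an explicit value when a + b = N - 1,
    mere finiteness otherwise. *)
Lemma ip_betaXX n a b (H : R) : let N := (2 * n.+1)%N in (a < N)%N -> (b < N)%N ->
  (\int[mu]_r (r * radial ((a - b) + (b - a)) n.+1 r)%:E = H%:E)%E ->
  ip_beta N ('X^a : {poly R[i]}) 'X^b =
  ((-1) ^+ (b < a)%N * (if ((a + b).+1 == N)%N then 2 * pi * H else 0))%:C.
Proof.
move=> N aN bN IH.
pose k := ((a - b) + (b - a))%N; pose sg : R := (-1) ^+ (b < a)%N.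
pose g := ang (a + b) N.-1.
pose F (z : R * R) : R[i] := let w := z.1 +i* z.2 in
    let w' := (conjc w)^-1 in
    tau N w * tau N w' * ((modulus w ^+ 2)^-1)%:C *
    (('X^a : {poly R[i]}).[w] * ('X^b : {poly R[i]}).[w'] - ('X^b : {poly R[i]}).[w] *
      ('X^a : {poly R[i]}).[w']).
have FE z : modulus (z.1 +i* z.2) < 1 -> F z = g z * (sg * radial k n.+1 (rho z))%:C.
  (* At w = 0, where [arg] is unspecified, both sides are 0: the inverse square of the modulus is 0
     by convention, and [radial] vanishes. *)
  move=> z1; have [w0|w0] := eqVneq (z.1 +i* z.2) 0.
    have r0 : rho z = 0 by move: w0 => [h1 h2]; rewrite /rho h1 h2 expr0n addr0 sqrtr0.
    rewrite r0 rad0// mulr0 mulr0 /F /= -/(rho z) r0 expr0n /= invr0.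
    by rewrite [X in _ * X * _](_ : _ = 0)// mulr0 mul0r.
  have [t01 wE] := arg_spec _ w0; have r0 := modulus_gt0 _ w0.
  have rE : rho z = modulus (z.1 +i* z.2) by [].
  have dE : dir z = expi (arg (z.1 +i* z.2)).
    have rn0 : (modulus (z.1 +i* z.2))%:C != 0 :> R[i] by apply/eqP => -[] /eqP;
      rewrite gt_eqF.
    apply: (mulfI rn0); rewrite -wE /dir rE.
    apply/eqP; rewrite eq_complex /= !mul0r subr0 addr0.
    by apply/andP; split; apply/eqP; rewrite mulrC divfK// gt_eqF.
  rewrite /F /g /ang dE rE; move: wE r0 t01 z1.
  move: (modulus _) (arg _) => r t -> r0 t01 r1.
  have r01 : 0 < r < 1 by rewrite r0.
  rewrite tau_reflect// conjc_inv_polar !hornerXn !exprMn.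
  have cX (x : R) c : x%:C ^+ c = (x ^+ c)%:C :> R[i] by rewrite rmorphXn.
  rewrite !cX conjc_expi -[expi (- t) ^+ _]expiMn.
  have -> : N.-1%:R * - t = - (2 * half_exponent n.+1 * t).
    have -> : N.-1%:R = N%:R - 1 :> R by rewrite /N mulnS addSn /= -natr1 addrK.
    by rewrite /half_exponent /N; move: ((2 * n.+1)%N%:R : R) => x; field.
  rewrite /radial patchE mem_setE in_itv/= r01 /rad_fun /k -/sg.
  have gen (s p q i x : R) : s * (p * (i * (i * q * x))) = p * x * (i * i) * (s * q) by
    ring.
  have ed : sg * (r ^- (a - b + (b - a)) - r ^+ (a - b + (b - a))) =
      r ^+ a * r^-1 ^+ b - r ^+ b * r^-1 ^+ a by rewrite expr_diff// gt_eqF.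
  rewrite gen ed -invfM -expr2 (exprD (expi t)).
  have cM (x y : R) : (x * y)%:C = x%:C * y%:C :> R[i] by rewrite rmorphM.
  have cB (x y : R) : (x - y)%:C = x%:C - y%:C :> R[i] by rewrite rmorphB.
  move: (expi t ^+ a) (expi t ^+ b) (expi (- (2 * half_exponent n.+1 * t))) => x1 x2 x3.
  move: ((Num.sqrt pi)^-1 : R) (tail n.+1 r) ((r ^+ 2)^-1) => y1 y2 y3.
  move: (r ^+ a) (r ^+ b) (r^-1 ^+ a) (r^-1 ^+ b) => u1 u2 u3 u4.
  rewrite !(cM, cB); move: (y1%:C) (y2%:C) (y3%:C) (u1%:C) (u2%:C) (u3%:C) (u4%:C) => *.
  ring.
(* [radial] vanishes outside the disk, so the integrals extend to the whole plane. *)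
have rho1 (z : R * R) : 1 <= rho z -> radial k n.+1 (rho z) = 0.
  by move=> h; rewrite /radial patchE mem_setE in_itv/= [rho z < 1]ltNge h andbF.
have FR (z : R * R) : ((fun z =>
  complex.Re (F z)) \_ [set z | modulus (z.1 +i* z.2) < 1]) z =
    sg * (complex.Re (g z) * radial k n.+1 (rho z)).
  rewrite patchE; case: ifPn => [|].
    rewrite inE /= => /FE ->; case: (g z) => x y /=; rewrite mulr0 subr0; ring.
  rewrite notin_setE /= => /negP; rewrite -leNgt => /rho1 ->.
  by rewrite !mulr0.
have FI (z : R * R) : ((fun z =>
  complex.Im (F z)) \_ [set z | modulus (z.1 +i* z.2) < 1]) z =
    sg * (complex.Im (g z) * radial k n.+1 (rho z)).
  rewrite patchE; case: ifPn => [|].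
    rewrite inE /= => /FE ->; case: (g z) => x y /=; rewrite mulr0 add0r; ring.
  rewrite notin_setE /= => /negP; rewrite -leNgt => /rho1 ->.
  by rewrite !mulr0.
have [mR mI] := cmeasurable_ang (a + b) N.-1.
have ReD (v w : R[i]) : complex.Re (v + w) = complex.Re v + complex.Re w by case: v w =>
  ? ? [].
have ImD (v w : R[i]) : complex.Im (v + w) = complex.Im v + complex.Im w by case: v w =>
  ? ? [].
have foldR (x y : R) : 0 < x -> 0 < y -> complex.Re (g (x, y)) + complex.Re (g (- x, y)) +
    (complex.Re (g (x, - y)) + complex.Re (g (- x, - y))) = ang_weight (a + b) N.-1 (y /
      x).
  by move=> x0 y0; rewrite -!ReD ang_fold.
have foldI (x y : R) : 0 < x -> 0 < y -> complex.Im (g (x, y)) + complex.Im (g (- x, y)) +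
    (complex.Im (g (x, - y)) + complex.Im (g (- x, - y))) = 0.
  by move=> x0 y0; rewrite -!ImD ang_fold.
have [iR eR] := @Rintegral_planar _ _ _ _ H mR (Re_ang_le1 (a + b) N.-1)
  (measurable_ang_weight (a + b) N.-1) (ang_weight_le4 _ _) (measurable_rad k n.+1)
  (rad_ge0 k n.+1) (rad0 k n.+1)
  foldR IH (integral_ang_weight _ _).
have Z4 : (\int[mu]_u ((0 < u)%R%:R * (4 + (fun=> 0) u) / (1 + u ^+ 2))%:E = (2 * pi +
  0)%:E)%E.
  by under eq_integral do rewrite addr0; rewrite addr0 integral_4.
have [iI eI] := @Rintegral_planar _ _ (fun=> 0) _ H mI (Im_ang_le1 (a + b) N.-1)
  (measurable_cst _) (fun _ => ltac:(by rewrite normr0)) (measurable_rad k n.+1)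
  (rad_ge0 k n.+1) (rad0 k n.+1)
  foldI IH Z4.
pose D := [set z : R * R | modulus (z.1 +i* z.2) < 1].
have cR : \int[(mu \x mu)%E]_(z in D) complex.Re (F z) =
    sg * ((if (a + b)%N == N.-1 then 2 * pi else 0) * H).
  rewrite Rintegral_mkcond; under eq_Rintegral do rewrite FR.
  by rewrite RintegralZl// eR.
have cI : \int[(mu \x mu)%E]_(z in D) complex.Im (F z) = 0.
  rewrite Rintegral_mkcond; under eq_Rintegral do rewrite FI.
  by rewrite RintegralZl// eI mul0r mulr0.
have -> : ip_beta N ('X^a : {poly R[i]}) 'X^b =
    (\int[(mu \x mu)%E]_(z in D) complex.Re (F z)) +i*
    (\int[(mu \x mu)%E]_(z in D) complex.Im (F z)) by [].
rewrite cR cI /sg.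
have -> : ((a + b)%N == N.-1) = ((a + b).+1 == N) by rewrite /N; lia.
by case: ifP => _; rewrite ?mul0r ?mulr0.
Qed.

End planar.

(** * Vanishing, antisymmetry and closed forms on monomials *)

Section skew_product.
Context {R : realType}.

Lemma ip_SXX0 n a b : let N := (2 * n.+1)%N in (a < N)%N -> (b < N)%N ->
  ((a + b).+1 != N)%N -> ip_S N ('X^a : {poly R[i]}) 'X^b = 0.
Proof.
move=> N aN bN /negbTE ab.
have [|H IH] := @integral_rad_fin R ((a - b) + (b - a)) n; first by rewrite /N in aN bN;
  lia.
by rewrite /ip_S ip_alphaXX (ip_betaXX _ _ _ H)// -/N ab mulr0 addr0.
Qed.

(** When a + b = N - 1, exchanging a and b negates b - (N-1)/2 in the alpha part and the sign in the
    beta part, while |a - b|, and with it H, is unchanged. *)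
Lemma ip_SXX_antisym n a b : let N := (2 * n.+1)%N in (a < N)%N -> (b < N)%N ->
  ip_S N ('X^a : {poly R[i]}) 'X^b = - ip_S N ('X^b : {poly R[i]}) 'X^a.
Proof.
move=> N aN bN.
have [abN|abN] := eqVneq (a + b).+1 N; last first.
  by rewrite !ip_SXX0// ?oppr0// addnC.
have [|H IH] := @integral_rad_fin R ((a - b) + (b - a)) n; first by rewrite /N in aN bN;
  lia.
have IH' : (\int[@lebesgue_measure R]_r (r * radial ((b - a) + (a - b)) n.+1 r)%:E =
  H%:E)%E.
  by rewrite addnC.
rewrite /ip_S !ip_alphaXX (ip_betaXX _ _ _ H)// (ip_betaXX _ _ _ H)// -/N [(b +
  a)%N]addnC abN eqxx.
have ea : a%:R - half_exponent n.+1 = - (b%:R - half_exponent n.+1) :> R.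
  by rewrite /half_exponent -/N -abN -[(a + b).+1%:R]natr1 [(a + b)%N%:R]natrD; field.
rewrite ea invrN mulrN mulNr.
(* a + b = N - 1 is odd, so a and b are distinct. *)
have -> : ((a < b) = ~~ (b < a))%N by rewrite /N in abN; lia.
move: (2 * pi / _ * _) (2 * pi * H) => x y.
by apply/eqP; rewrite eq_complex /=; apply/andP; split; apply/eqP; case: (b < a)%N;
  rewrite ?expr0 ?expr1; ring.
Qed.

Lemma Gamma_ratio n : Gamma (((2 * n)%:R + 1) / 2 : R) / Gamma ((2 * n)%:R / 2 + 1) =
  2 * wallis n / Num.sqrt pi.
Proof.
have -> : (2 * n)%:R / 2 + 1 = n%:R + 1 :> R by rewrite natrM; field.
have -> : ((2 * n)%:R + 1) / 2 = n%:R + 2^-1 :> R by rewrite natrM; field.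
have s0 : Num.sqrt pi != 0 :> R by rewrite gt_eqF// sqrtr_gt0 pi_gt0.
have f0 : n`!%:R != 0 :> R by rewrite pnatr_eq0 -lt0n fact_gt0.
rewrite Gamma_natE; apply: (mulIf f0); rewrite divfK//; apply: (mulfI s0).
rewrite -Gamma_half; field.
by rewrite s0.
Qed.

Lemma alpha_hatE n l : (l <= n)%N -> let N := (2 * n.+1)%N in
  ip_alpha N ('X^(2 * l) : {poly R[i]}) 'X^(N - 1 - 2 * l) =
  (2 * pi / (N%:R - 1 - 4 * l%:R) *
           (Gamma ((N%:R + 1) / 2) / Gamma (N%:R / 2 + 1)))%:C.
Proof.
move=> ln N; rewrite ip_alphaXX -/N.
have -> : ((2 * l + (N - 1 - 2 * l)).+1 == N)%N by rewrite /N; lia.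
rewrite Gamma_ratio; congr (_%:C).
have -> : (N - 1 - 2 * l)%:R - half_exponent n.+1 = (N%:R - 1 - 4 * l%:R) / 2 :> R.
  rewrite /half_exponent -/N !natrB; try by rewrite /N; lia.
  by rewrite natrM; field.
have s0 : Num.sqrt pi != 0 :> R by rewrite gt_eqF// sqrtr_gt0 pi_gt0.
rewrite invfM invrK.
by move: ((_ - _ - _)^-1) => x; field.
Qed.

(** With p = min(a, b) and k = |a - b| one gets p! (p + k)! = a! b!, and the sign divided by k is 1
    / (b - a) = 1 / (N - 1 - 4 l). *)
Lemma beta_hatE n l : (l <= n)%N -> let N := (2 * n.+1)%N in
  ip_beta N ('X^(2 * l) : {poly R[i]}) 'X^(N - 1 - 2 * l) =
  (2 * Num.sqrt pi / (N%:R - 1 - 4 * l%:R) *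
           (2 ^+ N * (Gamma (2 * l%:R + 1) * Gamma (N%:R - 2 * l%:R)
                      / Gamma (N%:R + 1))
            - Num.sqrt pi *
              (Gamma ((N%:R + 1) / 2) / Gamma (N%:R / 2 + 1))))%:C.
Proof.
move=> ln N.
rewrite [Gamma ((N%:R + 1) / 2) / _](Gamma_ratio n.+1).
pose a := (2 * l)%N; pose b := (N - 1 - 2 * l)%N; rewrite -/a -/b.
have aE : a = (2 * l)%N by [].
have abN : (a + b).+1 = N by rewrite /a /b /N; lia.
have ab : a <> b by rewrite /a /b /N; lia.
clearbody a b.
pose k := ((a - b) + (b - a))%N; pose p := minn a b.
have e : (2 * n.+1 = (2 * p + k).+1)%N by rewrite -/N -abN /p /k; lia.
have k0 : (0 < k)%N by rewrite /k; lia.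
rewrite (ip_betaXX _ _ _ _ _ _ (integral_rad p k n k0 e)) -/N; try by rewrite -/N -abN;
  lia.
rewrite abN eqxx; clear e; move: (wallis n.+1) => W; clearbody N.
have -> : Gamma (2 * l%:R + 1) = a`!%:R :> R by rewrite -natrM -aE Gamma_natE.
have -> : Gamma (N%:R - 2 * l%:R) = b`!%:R :> R.
  by rewrite -Gamma_natE; congr Gamma; rewrite -abN -natr1 natrD aE natrM; ring.
rewrite [Gamma (N%:R + 1)]Gamma_natE.
have -> : N%:R - 1 - 4 * l%:R = b%:R - a%:R :> R.
  by rewrite -abN -natr1 natrD aE natrM; ring.
have pab : p`!%:R * (p + k)`!%:R = a`!%:R * b`!%:R :> R.
  have [h|h] := leqP a b.
    have -> : p = a by rewrite /p; lia.
    by have -> : (a + k = b)%N by rewrite /k; lia.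
  have -> : p = b by rewrite /p; lia.
  by have -> : (b + k = a)%N; [rewrite /k; lia|rewrite mulrC].
rewrite pab.
have kE : (-1) ^+ (b < a)%N / k%:R = (b%:R - a%:R)^-1 :> R.
  have [h|h] := leqP a b.
    by rewrite expr0 mul1r -natrB//; congr (_%:R^-1); rewrite /k; lia.
  rewrite expr1 mulN1r -invrN; congr (_^-1).
  have -> : k = (a - b)%N by rewrite /k; lia.
  by rewrite natrB ?opprB// ltnW.
rewrite -kE.
have s0 : Num.sqrt pi != 0 :> R by rewrite gt_eqF// sqrtr_gt0 pi_gt0.
have s2 : pi = Num.sqrt pi * Num.sqrt pi :> R by rewrite -expr2 sqr_sqrtr// pi_ge0.
have kn0 : k%:R != 0 :> R by rewrite pnatr_eq0 -lt0n.
have N0 : N`!%:R != 0 :> R by rewrite pnatr_eq0 -lt0n fact_gt0.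
congr (_%:C); rewrite {1}s2.
move: ((-1) ^+ (b < a)%N : R) (a`!%:R : R) (b`!%:R : R) N0 kn0 => x1 x2 x3.
move: (N`!%:R : R) (k%:R : R) (2 ^+ N : R) => x4 x5 x6 N0 kn0.
field; by rewrite ?s0 ?N0 ?kn0.
Qed.

End skew_product.

Theorem proposition6p11 (R : realType) (N : nat) (q : nat -> {poly R[i]})
  (N_even : ~~ odd N)
  (q_even : forall j : nat, (j < N./2)%N -> q (2 * j)%N = 'X^(2 * j))
  (q_odd : forall j : nat, (j < N./2)%N ->
     q (2 * j + 1)%N = 'X^(N - 1 - 2 * j)) :
  let alpha_hat (l : nat) := ip_alpha N (q (2 * l)%N) (q (2 * l + 1)%N) in
  let beta_hat (l : nat) := ip_beta N (q (2 * l)%N) (q (2 * l + 1)%N) in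
  (forall j l : nat, (j < N./2)%N -> (l < N./2)%N ->
     [/\ ip_S N (q (2 * j)%N) (q (2 * l)%N) = 0,
         ip_S N (q (2 * j + 1)%N) (q (2 * l + 1)%N) = 0,
         ip_S N (q (2 * j)%N) (q (2 * l + 1)%N)
           = - ip_S N (q (2 * l + 1)%N) (q (2 * j)%N)
       & - ip_S N (q (2 * l + 1)%N) (q (2 * j)%N)
           = (j == l)%:R * (alpha_hat j + beta_hat j)])
  /\ (forall l : nat, (l < N./2)%N ->
        alpha_hat l =
          (2 * pi / (N%:R - 1 - 4 * l%:R) *
           (Gamma ((N%:R + 1) / 2) / Gamma (N%:R / 2 + 1)))%:C
     /\ beta_hat l =
          (2 * Num.sqrt pi / (N%:R - 1 - 4 * l%:R) *
           (2 ^+ N * (Gamma (2 * l%:R + 1) * Gamma (N%:R - 2 * l%:R)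
                      / Gamma (N%:R + 1))
            - Num.sqrt pi *
              (Gamma ((N%:R + 1) / 2) / Gamma (N%:R / 2 + 1))))%:C).
Proof.
move=> alpha_hat beta_hat.
have NE : N = (2 * N./2)%N by lia.
(* For N = 0 there are no indices and the claim is vacuous. *)
case: (N./2) NE q_even q_odd => [_ _ _|n NE q_even q_odd]; first by split.
subst N; split=> [j l jn ln|l ln]; last first.
  by rewrite /alpha_hat /beta_hat q_even// q_odd// alpha_hatE// beta_hatE.
have anti : ip_S (2 * n.+1) (q (2 * j)%N) (q (2 * l + 1)%N) =
    - ip_S (2 * n.+1) (q (2 * l + 1)%N) (q (2 * j)%N).
  by rewrite q_even// q_odd// ip_SXX_antisym//; lia.
split=> //.
(* Two exponents of equal parity never add up to the odd number N - 1. *)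
- by rewrite !q_even// ip_SXX0//; lia.
- by rewrite !q_odd// ip_SXX0//; lia.
(* The exponents 2 j and N - 1 - 2 l add up to N - 1 only for j = l. *)
rewrite -anti; have [->|jl] := eqVneq j l; first by rewrite mul1r.
by rewrite mul0r q_even// q_odd// ip_SXX0//; lia.
Qed.
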